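(* Let $A$ be a Noetherian ring, $R=A[[x]]$, $x=(x_1,\dots,x_n)$, and $M$ a finitely generated $R$-module. Let $\mathfrak p\in\operatorname{Spec}A$ and assume that one of the following conditions is satisfied: 1. $M$ is finitely generated as an $A$-module (e.g. $\operatorname{Supp}_R(M)\subset V(\langle x\rangle)$), or 2. $\dim A=1$, or 3. $M$ is algebraically $R$-presented, or 4. $(A,\mathfrak m,\Bbbk)$ is a complete local ring containing a field. Then there is an open neighbourhood $U\subset\operatorname{Spec}A$ of $\mathfrak p$ such that $\hat d_{\mathfrak q}(M)\le\hat d_{\mathfrak p}(M)$ for all $\mathfrak q\in U$. In particular, the quasi-completed-finite locus $\{\mathfrak p\in\operatorname{Spec}A\mid\hat d_{\mathfrak p}(M)<\infty\}$ is open.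
   Context: Rings are commutative with unit. $R=A[[x_1,\dots,x_n]]$ is the formal power series ring and $\langle x\rangle=\langle x_1,\dots,x_n\rangle\subset R$. For $\mathfrak p\in\operatorname{Spec}A$ let $k(\mathfrak p)=A_{\mathfrak p}/\mathfrak pA_{\mathfrak p}$. For an $R$-module $M$ the completed fibre over $\mathfrak p$ is $$\hat M(\mathfrak p):=\varprojlim_m\big((M/\langle x\rangle^mM)\otimes_A k(\mathfrak p)\big),$$ and $\hat d_{\mathfrak p}(M):=\dim_{k(\mathfrak p)}\hat M(\mathfrak p)\in\mathbb N\cup\{\infty\}$. $\dim A$ is the Krull dimension. $M$ is algebraically $R$-presented if there is a presentation $R^p\xrightarrow{T}R^q\to M\to0$ in which all entries of $T$ lie in $A\langle x\rangle$. Here $A\langle x\rangle$, the ring of algebraic power series over $A$, is the Henselization of $A[x]$ with respect to $\langle x\rangle$, i.e. $\varinjlim B$ over all étale ring maps $A[x]\to B$ inducing an isomorphism $A[x]/\langle x\rangle\cong B/\langle x\rangle B$; for $A$ Noetherian it is regarded as a subring of its $\langle x\rangle$-adic completion $A[[x]]$. *)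

(* Defs.v *)
From HB Require Import structures.
From mathcomp Require Import all_boot all_order all_algebra.
From mathcomp Require Import generic_quotient ring_quotient.
From mathcomp Require Import ring.
From mathcomp Require Import boolp classical_sets topology.
From mathcomp.multinomials Require Import freeg mpoly.

Set Implicit Arguments.
Unset Strict Implicit.
Unset Printing Implicit Defensive.

Import GRing.Theory.

Local Open Scope classical_set_scope.
Local Open Scope ring_scope.
Local Open Scope quotient_scope.

Section Span.
Variables (R : pzRingType) (V : lmodType R).

Definition span (G : set V) : {pred V} := fun v =>
  `[< exists k (c : 'I_k -> R) (g : 'I_k -> V),
        (forall i, G (g i)) /\ v = \sum_i c i *: g i >].

Variable G : set V.

Lemma spanP v : reflect (exists k (c : 'I_k -> R) (g : 'I_k -> V),
  (forall i, G (g i)) /\ v = \sum_i c i *: g i) (v \in span G).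
Proof. exact: asboolP. Qed.

Lemma span_submod_closed : submod_closed (span G).
Proof.
split; first by apply/spanP; exists 0, (fun=> 0), (fun=> 0); split;
  [case | rewrite big_ord0].
move=> a u v /spanP[k [c [g [Gg ->]]]] /spanP[l [d [h [Gh ->]]]].
apply/spanP; exists (k + l)%N.
exists (fun i => match split i with inl j => a * c j | inr j => d j end).
exists (fun i => match split i with inl j => g j | inr j => h j end).
split=> [i|]; first by case: (split i).
rewrite big_split_ord scaler_sumr; congr (_ + _); apply: eq_bigr => i _.
  by rewrite (unsplitK (inl i)) scalerA.
by rewrite (unsplitK (inr i)).
Qed.

HB.instance Definition _ :=
  GRing.isSubmodClosed.Build R V (span G) span_submod_closed.

Lemma mem_span v : G v -> v \in span G.
Proof.
move=> Gv; apply/spanP; exists 1, (fun=> 1), (fun=> v); split=> //.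
by rewrite big_ord1 scale1r.
Qed.

Lemma span0 : 0 \in span G.
Proof. exact: rpred0. Qed.

Lemma spanD u v : u \in span G -> v \in span G -> u + v \in span G.
Proof. exact: rpredD. Qed.

Lemma spanZ a v : v \in span G -> a *: v \in span G.
Proof. exact: rpredZ. Qed.

End Span.

Lemma sub_span (R : pzRingType) (V : lmodType R) (G G' : set V) :
  (forall v, G v -> v \in span G') -> {subset span G <= span G'}.
Proof.
move=> GG' v /spanP[k [c [g [Gg ->]]]].
by apply: rpred_sum => i _; apply/rpredZ/GG'.
Qed.

Section QuotientModule.
Variables (R : pzRingType) (V : lmodType R) (G : set V).
Local Notation U := (span G).

(* G is only a generating set of the submodule that is killed. *)
Definition quotmod : Type := {ideal_quot U}.
HB.instance Definition _ := GRing.Zmodule.on quotmod.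

Definition quotmod_pi (v : V) : quotmod := \pi_({ideal_quot U}) v.
Definition quotmod_repr (x : quotmod) : V := repr (x : {ideal_quot U}).

Lemma quotmod_reprK : cancel quotmod_repr quotmod_pi.
Proof. exact: reprK. Qed.

Lemma quotmod_eqP u v : reflect (quotmod_pi u = quotmod_pi v) (u - v \in U).
Proof. by rewrite Quotient.idealrBE; apply: eqP. Qed.

Lemma quotmod_piB : {morph quotmod_pi : u v / u - v}.
Proof. exact: (raddfB (\pi_({ideal_quot U}) : {additive V -> {ideal_quot U}})). Qed.

Lemma quotmod_piD : {morph quotmod_pi : u v / u + v}.
Proof. exact: (raddfD (\pi_({ideal_quot U}) : {additive V -> {ideal_quot U}})). Qed.

Definition quotmod_scale (a : R) (x : quotmod) : quotmod :=
  quotmod_pi (a *: quotmod_repr x).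

Lemma quotmod_piZ a v : quotmod_pi (a *: v) = quotmod_scale a (quotmod_pi v).
Proof.
apply/quotmod_eqP; rewrite -scalerBr; apply: rpredZ.
by apply/quotmod_eqP; rewrite quotmod_reprK.
Qed.

Fact quotmod_scaleA a b x :
  quotmod_scale a (quotmod_scale b x) = quotmod_scale (a * b) x.
Proof. by rewrite -[x]quotmod_reprK -!quotmod_piZ scalerA. Qed.

Fact quotmod_scale1 : left_id 1 quotmod_scale.
Proof. by move=> x; rewrite -[x]quotmod_reprK -quotmod_piZ scale1r. Qed.

Fact quotmod_scaleDr : right_distributive quotmod_scale +%R.
Proof.
move=> a x y; rewrite -[x]quotmod_reprK -[y]quotmod_reprK.
by rewrite -quotmod_piD -!quotmod_piZ scalerDr quotmod_piD.
Qed.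

Fact quotmod_scaleDl x :
  {morph quotmod_scale^~ x : a b / a + b >-> a + b}.
Proof.
move=> a b; rewrite -[x]quotmod_reprK.
by rewrite -!quotmod_piZ scalerDl quotmod_piD.
Qed.

HB.instance Definition _ := GRing.Zmodule_isLmodule.Build R quotmod
  quotmod_scaleA quotmod_scale1 quotmod_scaleDr quotmod_scaleDl.

Fact quotmod_pi_linear : linear quotmod_pi.
Proof. by move=> a u v; rewrite quotmod_piD quotmod_piZ. Qed.

HB.instance Definition _ :=
  GRing.isLinear.Build R V quotmod *:%R quotmod_pi quotmod_pi_linear.

End QuotientModule.

Section QuotientProjection.
Variables (R : pzRingType) (V : lmodType R) (G G' : set V).
Hypothesis sGG' : {subset span G <= span G'}.

Definition quotmod_proj of {subset span G <= span G'} := fun x : quotmod G =>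
  quotmod_pi G' (quotmod_repr x).
Local Notation proj := (quotmod_proj sGG').

Lemma quotmod_projE v : proj (quotmod_pi G v) = quotmod_pi G' v.
Proof.
by apply/quotmod_eqP/sGG'/quotmod_eqP; rewrite quotmod_reprK.
Qed.

Fact quotmod_proj_linear : linear proj.
Proof.
move=> a x y; rewrite -[x]quotmod_reprK -[y]quotmod_reprK.
by rewrite -linearP !quotmod_projE linearP.
Qed.

HB.instance Definition _ := GRing.isLinear.Build R (quotmod G) (quotmod G')
  *:%R proj quotmod_proj_linear.

End QuotientProjection.

Section RestrictScalars.
Variables (A R : pzRingType) (f : {rmorphism A -> R}).

Definition restr of {rmorphism A -> R} := fun M : lmodType R => (M : Type).

Variable M : lmodType R.
HB.instance Definition _ := GRing.Zmodule.on (restr f M).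

Definition restr_scale (a : A) (v : restr f M) : restr f M :=
  f a *: (v : M).

Fact restr_scaleA a b v :
  restr_scale a (restr_scale b v) = restr_scale (a * b) v.
Proof. by rewrite /restr_scale scalerA rmorphM. Qed.

Fact restr_scale1 : left_id 1 restr_scale.
Proof. by move=> v; rewrite /restr_scale rmorph1 scale1r. Qed.

Fact restr_scaleDr : right_distributive restr_scale +%R.
Proof. by move=> a u v; rewrite /restr_scale scalerDr. Qed.

Fact restr_scaleDl v : {morph restr_scale^~ v : a b / a + b >-> a + b}.
Proof. by move=> a b; rewrite /restr_scale rmorphD scalerDl. Qed.

HB.instance Definition _ := GRing.Zmodule_isLmodule.Build A (restr f M)
  restr_scaleA restr_scale1 restr_scaleDr restr_scaleDl.

End RestrictScalars.

Section RestrictMap.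
Variables (A R : pzRingType) (f : {rmorphism A -> R}).
Variables (M N : lmodType R) (g : {linear M -> N}).

Definition restr_map (v : restr f M) : restr f N := g (v : M).

Fact restr_map_linear : linear restr_map.
Proof. by move=> a u v; rewrite /restr_map linearP. Qed.

HB.instance Definition _ := GRing.isLinear.Build A (restr f M) (restr f N)
  *:%R restr_map restr_map_linear.

End RestrictMap.
Arguments restr_map {A R} f {M N} g v.

Section Tensor.
Variables (A : comPzRingType) (B : comNzRingType) (f : {rmorphism A -> B}).

Section Object.
Variable N : lmodType A.
Local Notation FG := {freeg (N * B)%type / int}.

Definition tensor_sym (n : N) (b : B) : FG := << (n, b) >>.

Inductive tensor_rel : set FG :=
| TensorDl n n' b :
    tensor_rel (tensor_sym (n + n') b - tensor_sym n b - tensor_sym n' b)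
| TensorDr n b b' :
    tensor_rel (tensor_sym n (b + b') - tensor_sym n b - tensor_sym n b')
| TensorZ a n b :
    tensor_rel (tensor_sym (a *: n) b - tensor_sym n (f a * b)).

(* N (x)_A B for the A-algebra f : A -> B. It becomes a B-module, with
   c (n (x) b) = n (x) c b, through tensor_scale below. *)
Definition tensor : Type := quotmod tensor_rel.
HB.instance Definition _ := GRing.Zmodule.on tensor.

Definition tensor_pi (x : FG) : tensor := quotmod_pi tensor_rel x.
Definition tensor_repr (x : tensor) : FG := quotmod_repr x.

Lemma tensor_reprK : cancel tensor_repr tensor_pi.
Proof. exact: quotmod_reprK. Qed.

Lemma tensor_piD : {morph tensor_pi : x y / x + y}.
Proof. exact: quotmod_piD. Qed.

Lemma tensor_eqP x y :
  reflect (tensor_pi x = tensor_pi y) (x - y \in span tensor_rel).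
Proof. exact: quotmod_eqP. Qed.

End Object.

Section Lift.
Variables (N N' : lmodType A) (h : N * B -> N' * B).
Local Notation FG := {freeg (N * B)%type / int}.
Local Notation FG' := {freeg (N' * B)%type / int}.

Definition fgpush (x : FG) : FG' := fglift (fun p => << h p >> : FG') x.

Lemma fgpushB : {morph fgpush : x y / x - y}.
Proof. exact: lift_is_additive. Qed.

Lemma fgpush0 : fgpush 0 = 0.
Proof. by rewrite -(subrr 0) fgpushB subrr. Qed.

Lemma fgpushN x : fgpush (- x) = - fgpush x.
Proof. by rewrite -sub0r fgpushB fgpush0 sub0r. Qed.

Lemma fgpushD : {morph fgpush : x y / x + y}.
Proof. by move=> x y; rewrite -{1}[y]opprK fgpushB fgpushN opprK. Qed.

Lemma fgpushU k p : fgpush << k *g p >> = << k *g h p >>.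
Proof.
rewrite /fgpush liftU; apply/eqP/freeg_eqP => q.
by rewrite coeffZ !coeffU mul1r.
Qed.

Lemma fgpushZ (k : int) x : fgpush (k *: x) = k *: fgpush x.
Proof.
have P (n : nat) : fgpush (n%:Z *: x) = n%:Z *: fgpush x.
  elim: n => [|n IH]; first by rewrite !scale0r fgpush0.
  by rewrite intS !scalerDl !scale1r fgpushD IH.
by case: k => n //; rewrite NegzE !scaleNr fgpushN P.
Qed.

Hypothesis h_rel : forall x, tensor_rel x -> fgpush x \in span (@tensor_rel N').

Lemma fgpush_span x : x \in span (@tensor_rel N) ->
  fgpush x \in span (@tensor_rel N').
Proof.
move=> /spanP[k [c [g [Gg ->]]]].
rewrite (big_morph fgpush fgpushD fgpush0).
by apply: rpred_sum => i _; rewrite fgpushZ; apply/rpredZ/h_rel.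
Qed.

Lemma fgpush_pi x y : tensor_pi x = tensor_pi y ->
  tensor_pi (fgpush x) = tensor_pi (fgpush y).
Proof.
by move=> /tensor_eqP xy; apply/tensor_eqP; rewrite -fgpushB; apply: fgpush_span.
Qed.

End Lift.

Section Module.
Variable N : lmodType A.

Definition tensor_act (c : B) := fgpush (fun p : N * B => (p.1, c * p.2)).

Lemma tensor_act_rel c x : tensor_rel x ->
  tensor_act c x \in span (@tensor_rel N).
Proof.
rewrite /tensor_act.
case=> [n n' b|n b b'|a n b]; rewrite !fgpushB !fgpushU /=.
- by exact/mem_span/TensorDl.
- by rewrite mulrDr; exact/mem_span/TensorDr.
- by rewrite mulrCA; exact/mem_span/TensorZ.
Qed.

Definition tensor_scale (c : B) (x : tensor N) : tensor N :=
  tensor_pi (tensor_act c (tensor_repr x)).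

Lemma tensor_piZ c x :
  tensor_pi (tensor_act c x) = tensor_scale c (tensor_pi x).
Proof.
apply: fgpush_pi; first exact: tensor_act_rel.
by rewrite tensor_reprK.
Qed.

Fact tensor_scaleA a b x :
  tensor_scale a (tensor_scale b x) = tensor_scale (a * b) x.
Proof.
rewrite -[x]tensor_reprK -!tensor_piZ; congr tensor_pi.
elim/freeg_ind_dom0: (tensor_repr x) => [|k p D _ _ IH].
  by rewrite /tensor_act !fgpush0.
by move: IH; rewrite /tensor_act !fgpushD !fgpushU /= mulrA => ->.
Qed.

Fact tensor_scale1 : left_id 1 tensor_scale.
Proof.
move=> x; rewrite -[x]tensor_reprK -tensor_piZ; congr tensor_pi.
elim/freeg_ind_dom0: (tensor_repr x) => [|k p D _ _ IH].
  by rewrite /tensor_act fgpush0.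
by move: IH; rewrite /tensor_act fgpushD fgpushU /= mul1r -surjective_pairing => ->.
Qed.

Fact tensor_scaleDr : right_distributive tensor_scale +%R.
Proof.
move=> a x y; rewrite -[x]tensor_reprK -[y]tensor_reprK.
by rewrite -tensor_piD -!tensor_piZ -tensor_piD /tensor_act fgpushD.
Qed.

Fact tensor_scaleDl x : {morph tensor_scale^~ x : a b / a + b >-> a + b}.
Proof.
move=> a b; rewrite -[x]tensor_reprK -!tensor_piZ -tensor_piD.
apply/tensor_eqP; rewrite opprD addrA.
elim/freeg_ind_dom0: (tensor_repr x) => [|k p D _ _ IH].
  by rewrite /tensor_act !fgpush0 !subr0 rpred0.
move: IH; rewrite /tensor_act !fgpushD !fgpushU /=.
set X := fgpush _ _; set Y := fgpush _ _; set Z := fgpush _ _ => IH.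
have -> : forall u v w : {freeg (N * B)%type / int},
  u + X - (v + Y) - (w + Z) = (u - v - w) + (X - Y - Z).
  by move=> u v w; rewrite (opprD v) (opprD w) [u + X + _]addrACA [LHS]addrACA.
apply: rpredD => //.
have E q : << k *g q >> = k *: << q >> :> {freeg (N * B)%type / int}.
  by apply/eqP/freeg_eqP => r; rewrite coeffZ !coeffU mul1r.
rewrite mulrDl !E -!scalerBr; apply: rpredZ.
exact/mem_span/TensorDr.
Qed.

HB.instance Definition _ := GRing.Zmodule_isLmodule.Build B (tensor N)
  tensor_scaleA tensor_scale1 tensor_scaleDr tensor_scaleDl.

End Module.

Section Map.
Variables (N N' : lmodType A) (g : {linear N -> N'}).

Definition tensor_push := fgpush (fun p : N * B => (g p.1, p.2)).

Lemma tensor_push_rel x : tensor_rel x ->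
  tensor_push x \in span (@tensor_rel N').
Proof.
rewrite /tensor_push.
case=> [n n' b|n b b'|a n b]; rewrite !fgpushB !fgpushU /=.
- by rewrite linearD; exact/mem_span/TensorDl.
- by exact/mem_span/TensorDr.
- by rewrite linearZ; exact/mem_span/TensorZ.
Qed.

Definition tensor_map (x : tensor N) : tensor N' :=
  tensor_pi (tensor_push (tensor_repr x)).

Lemma tensor_mapE x : tensor_map (tensor_pi x) = tensor_pi (tensor_push x).
Proof. by apply: fgpush_pi; [exact: tensor_push_rel | rewrite tensor_reprK]. Qed.

Fact tensor_map_linear : linear tensor_map.
Proof.
move=> c x y; rewrite -[x]tensor_reprK -[y]tensor_reprK.
rewrite -[c *: _]tensor_piZ -tensor_piD !tensor_mapE.
rewrite -[c *: _]tensor_piZ -tensor_piD; congr tensor_pi.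
rewrite /tensor_push fgpushD; congr (_ + _).
elim/freeg_ind_dom0: (tensor_repr x) => [|k p D _ _ IH].
  by rewrite /tensor_act !fgpush0.
by move: IH; rewrite /tensor_act !fgpushD !fgpushU /= => ->.
Qed.

HB.instance Definition _ := GRing.isLinear.Build B (tensor N) (tensor N')
  *:%R tensor_map tensor_map_linear.

End Map.
End Tensor.
Arguments tensor_map {A B} f {N N'} g x.

Record Spec (A : comNzRingType) := MkSpec {
  prime_set :> A -> bool;
  prime_setP : idealr_closed prime_set /\ prime_idealr_closed prime_set
}.

HB.instance Definition _ (A : comNzRingType) (p : Spec A) :=
  isIdealr.Build A (prime_set p) (prime_setP p).1.
HB.instance Definition _ (A : comNzRingType) (p : Spec A) :=
  isPrimeIdealrClosed.Build A (prime_set p) (prime_setP p).2.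

Section Localization.
Variables (A : comNzRingType) (p : Spec A).

Fact prime_compl1 : 1 \notin prime_set p.
Proof. by rewrite idealr1. Qed.

Fact prime_complM (s t : {s : A | s \notin prime_set p}) :
  sval s * sval t \notin prime_set p.
Proof. by rewrite prime_idealrM negb_or (svalP s) (svalP t). Qed.

(* The pair (a, s) stands for the fraction a / s, and the quotient of these
   pairs by loc_equiv is the local ring A_p; its maximal ideal pA_p is loc_max
   and k(p) = A_p / pA_p is residue_field. *)
Definition locfrac := (A * {s : A | s \notin prime_set p})%type.
Implicit Types x y z : locfrac.

Definition loc_equiv x y : bool :=
  `[< exists2 u, u \notin prime_set p &
        u * (x.1 * sval y.2) = u * (y.1 * sval x.2) >].

Lemma loc_equivP x y : reflect (exists2 u, u \notin prime_set p &
  u * (x.1 * sval y.2) = u * (y.1 * sval x.2)) (loc_equiv x y).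
Proof. exact: asboolP. Qed.

Fact loc_equiv_refl : reflexive loc_equiv.
Proof. by move=> x; apply/loc_equivP; exists 1; rewrite ?prime_compl1. Qed.

Fact loc_equiv_sym : ssrbool.symmetric loc_equiv.
Proof.
by move=> x y; apply/loc_equivP/loc_equivP => -[u up e]; exists u.
Qed.

Fact loc_equiv_trans : transitive loc_equiv.
Proof.
move=> y x z /loc_equivP[u up e] /loc_equivP[v vp e'].
apply/loc_equivP; exists (u * v * sval y.2).
  by rewrite !prime_idealrM !negb_or up vp (svalP y.2).
transitivity (v * sval z.2 * (u * (x.1 * sval y.2))); first by ring.
rewrite e; transitivity (u * sval x.2 * (v * (y.1 * sval z.2))); first by ring.
by rewrite e'; ring.
Qed.

Canonical loc_equiv_equiv :=
  EquivRel loc_equiv loc_equiv_refl loc_equiv_sym loc_equiv_trans.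

Definition localization : Type := {eq_quot loc_equiv}.
HB.instance Definition _ : EqQuotient _ loc_equiv localization :=
  EqQuotient.on localization.
HB.instance Definition _ := Choice.on localization.

Lemma loc_eqP x y : reflect (exists2 u, u \notin prime_set p &
    u * (x.1 * sval y.2) = u * (y.1 * sval x.2))
  (\pi_localization x == \pi_localization y).
Proof. by rewrite eqmodE; apply: loc_equivP. Qed.

Definition mkloc (a : A) (s : A) (sp : s \notin prime_set p) : locfrac :=
  (a, exist _ s sp).

Definition loc_addf x y : locfrac :=
  mkloc (x.1 * sval y.2 + y.1 * sval x.2) (prime_complM x.2 y.2).
Definition loc_oppf x : locfrac := (- x.1, x.2).
Definition loc_mulf x y : locfrac := mkloc (x.1 * y.1) (prime_complM x.2 y.2).

Definition loc_add := lift_op2 localization loc_addf.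
Definition loc_opp := lift_op1 localization loc_oppf.
Definition loc_mul := lift_op2 localization loc_mulf.
Definition tolocf (a : A) : locfrac := mkloc a prime_compl1.
Definition toloc : A -> localization := lift_embed localization tolocf.
Canonical toloc_pi_morph := PiEmbed toloc.

Lemma loc_repr x : exists2 u, u \notin prime_set p &
  u * ((repr (\pi_localization x)).1 * sval x.2) =
  u * (x.1 * sval (repr (\pi_localization x)).2).
Proof. by apply/loc_eqP; rewrite reprK. Qed.

Lemma pi_loc_add : {morph \pi_localization : x y / loc_addf x y >-> loc_add x y}.
Proof.
move=> x y; unlock loc_add; apply/eqP/loc_eqP => /=.
have [u up e] := loc_repr x; have [v vp e'] := loc_repr y.
move: (repr _) e (repr _) e' => x' e y' e'.
exists (u * v); first by rewrite prime_idealrM negb_or up.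
transitivity (v * sval y.2 * sval y'.2 * (u * (x.1 * sval x'.2)) +
  u * sval x.2 * sval x'.2 * (v * (y.1 * sval y'.2))); first by ring.
by rewrite -e -e'; ring.
Qed.
Canonical pi_loc_add_morph := PiMorph2 pi_loc_add.

Lemma pi_loc_opp : {morph \pi_localization : x / loc_oppf x >-> loc_opp x}.
Proof.
move=> x; unlock loc_opp; apply/eqP/loc_eqP => /=.
have [u up e] := loc_repr x; exists u => //.
by rewrite !mulNr !mulrN e.
Qed.
Canonical pi_loc_opp_morph := PiMorph1 pi_loc_opp.

Lemma pi_loc_mul : {morph \pi_localization : x y / loc_mulf x y >-> loc_mul x y}.
Proof.
move=> x y; unlock loc_mul; apply/eqP/loc_eqP => /=.
have [u up e] := loc_repr x; have [v vp e'] := loc_repr y.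
move: (repr _) e (repr _) e' => x' e y' e'.
exists (u * v); first by rewrite prime_idealrM negb_or up.
transitivity ((u * (x.1 * sval x'.2)) * (v * (y.1 * sval y'.2))); first by ring.
by rewrite -e -e'; ring.
Qed.
Canonical pi_loc_mul_morph := PiMorph2 pi_loc_mul.

Lemma loc_eq1 x y : x.1 * sval y.2 = y.1 * sval x.2 ->
  \pi_localization x = \pi_localization y.
Proof.
by move=> e; apply/eqP/loc_eqP; exists 1; rewrite ?prime_compl1 ?e.
Qed.

Fact loc_addA : associative loc_add.
Proof.
elim/quotW=> x; elim/quotW=> y; elim/quotW=> z; rewrite !piE.
by apply: loc_eq1 => /=; ring.
Qed.

Fact loc_addC : commutative loc_add.
Proof.
elim/quotW=> x; elim/quotW=> y; rewrite !piE.
by apply: loc_eq1 => /=; ring.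
Qed.

Fact loc_add0 : left_id (toloc 0) loc_add.
Proof.
by elim/quotW=> x; rewrite !piE; apply: loc_eq1 => /=; ring.
Qed.

Fact loc_addN : left_inverse (toloc 0) loc_opp loc_add.
Proof.
by elim/quotW=> x; rewrite !piE; apply: loc_eq1 => /=; ring.
Qed.

HB.instance Definition _ :=
  GRing.isZmodule.Build localization loc_addA loc_addC loc_add0 loc_addN.

Fact loc_mulA : associative loc_mul.
Proof.
elim/quotW=> x; elim/quotW=> y; elim/quotW=> z; rewrite !piE.
by apply: loc_eq1 => /=; ring.
Qed.

Fact loc_mulC : commutative loc_mul.
Proof.
elim/quotW=> x; elim/quotW=> y; rewrite !piE.
by apply: loc_eq1 => /=; ring.
Qed.

Fact loc_mul1 : left_id (toloc 1) loc_mul.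
Proof.
by elim/quotW=> x; rewrite !piE; apply: loc_eq1 => /=; ring.
Qed.

Fact loc_mulDl : left_distributive loc_mul loc_add.
Proof.
elim/quotW=> x; elim/quotW=> y; elim/quotW=> z; rewrite !piE.
by apply: loc_eq1 => /=; ring.
Qed.

Fact loc_one_neq0 : toloc 1 != toloc 0.
Proof.
rewrite !piE; apply/negP => /loc_equivP[u up] /= e; case/negP: up.
by move: e; rewrite !mul1r mul0r mulr0 mulr1 => ->; rewrite idealr0.
Qed.

HB.instance Definition _ := GRing.Zmodule_isComNzRing.Build localization
  loc_mulA loc_mulC loc_mul1 loc_mulDl loc_one_neq0.

Fact toloc_zmod_morphism : zmod_morphism toloc.
Proof.
move=> a b; rewrite -[RHS]/(loc_add (toloc a) (loc_opp (toloc b))) !piE.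
by apply: loc_eq1 => /=; ring.
Qed.

Fact toloc_monoid_morphism : monoid_morphism toloc.
Proof.
split=> // a b; rewrite -[RHS]/(loc_mul (toloc a) (toloc b)) !piE.
by apply: loc_eq1 => /=; ring.
Qed.

HB.instance Definition _ :=
  GRing.isZmodMorphism.Build A localization toloc toloc_zmod_morphism.
HB.instance Definition _ :=
  GRing.isMonoidMorphism.Build A localization toloc toloc_monoid_morphism.

Definition loc_max : {pred localization} :=
  @span localization localization^o
    (fun y : localization => exists2 a, a \in prime_set p & y = toloc a).

Lemma pi_locfrac (a s : A) (sp : s \notin prime_set p) :
  \pi_localization (mkloc a sp) = \pi_localization (mkloc 1 sp) * toloc a.
Proof.
rewrite -[_ * _]/(loc_mul _ _) !piE; apply: loc_eq1 => /=; ring.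
Qed.

Lemma loc_maxP (y : localization) : reflect (exists2 x : locfrac, x.1 \in prime_set p &
  y = \pi_localization x) (y \in loc_max).
Proof.
apply: (iffP idP) => [/spanP[k [c [g [Gg ->]]]]|[[a [s sp]] /= ap ->]]; last first.
  rewrite (pi_locfrac a sp).
  apply: (@spanZ localization localization^o).
  by apply: mem_span; exists a.
elim/big_ind: _ => [|_ _ [x xp ->] [y' yp ->]|i _].
- by exists (tolocf 0); rewrite /= ?idealr0 // -[LHS]/(toloc 0) piE.
- exists (loc_addf x y') => /=.
    by rewrite rpredD // mulrC prime_idealrM ?xp ?yp orbT.
  by rewrite -[LHS]/(loc_add _ _) piE.
- have [a ap ->] := Gg i; elim/quotW: (c i) => x.
  exists (loc_mulf x (tolocf a)); first by rewrite prime_idealrM ap orbT.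
  by rewrite -[LHS]/(loc_mul _ _) !piE.
Qed.

Fact loc_max_idealr_closed : idealr_closed loc_max.
Proof.
split.
- exact: (@span0 localization localization^o).
- apply/loc_maxP => -[[a [s sp]] /= ap].
  rewrite -[1]/(toloc 1) piE => /eqP/loc_eqP[u up] /= e.
  have : u * (1 * s) \in prime_set p.
    by rewrite e mulr1 prime_idealrM ap orbT.
  by rewrite mul1r prime_idealrM (negPf up) (negPf sp).
- move=> a u v um vm; apply: (@spanD localization localization^o) => //.
  exact: (@spanZ localization localization^o).
Qed.

HB.instance Definition _ :=
  isIdealr.Build localization loc_max loc_max_idealr_closed.

Definition residue_field : Type := {ideal_quot loc_max}.
HB.instance Definition _ := GRing.ComNzRing.on residue_field.

Definition residue_pi : {rmorphism localization -> residue_field} :=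
  \pi_({ideal_quot loc_max}).

Fact residue_inv_ex (x : residue_field) : x != 0 -> exists y : residue_field, y * x = 1.
Proof.
elim/quotW: x => x /eqP x0; elim/quotW: x x0 => -[a [s sp]] x0.
have [ap|ap] := boolP (a \in prime_set p).
  case: x0; rewrite -[RHS](rmorph0 residue_pi); apply/eqP.
  rewrite -Quotient.idealrBE subr0; apply/loc_maxP.
  by exists (a, exist _ s sp).
exists (residue_pi (\pi_localization (mkloc s ap))).
rewrite -[_ * _]/(residue_pi _ * residue_pi _) -rmorphM -[RHS](rmorph1 residue_pi).
congr (residue_pi _); rewrite -[LHS]/(loc_mul _ _) -[RHS]/(toloc 1) !piE.
by apply: loc_eq1 => /=; ring.
Qed.

Definition residue_inv (x : residue_field) : residue_field :=
  if pselect (exists y : residue_field, y * x = 1) is left h then projT1 (cid h) else 0.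

Fact residue_mulV (x : residue_field) : x != 0 -> residue_inv x * x = 1.
Proof.
move=> /residue_inv_ex h; rewrite /residue_inv.
by case: pselect => // h'; case: cid.
Qed.

Fact residue_inv0 : residue_inv 0 = 0.
Proof.
rewrite /residue_inv; case: pselect => // h; exfalso; case: h => y.
by rewrite mulr0 => /eqP; rewrite eq_sym oner_eq0.
Qed.

HB.instance Definition _ :=
  GRing.ComNzRing_isField.Build residue_field residue_mulV residue_inv0.

Definition to_residue : {rmorphism A -> residue_field} := residue_pi \o toloc.

End Localization.

Section Zariski.
Variable A : comNzRingType.

HB.instance Definition _ := gen_eqMixin (Spec A).
HB.instance Definition _ := gen_choiceMixin (Spec A).

Definition zariski_compl (E : set A) : set (Spec A) :=
  [set q : Spec A | exists2 a, E a & a \notin prime_set q].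

Definition zariski_open : set_system (Spec A) :=
  [set U | exists E, U = zariski_compl E].

Fact zariski_openT : zariski_open setT.
Proof.
exists setT; apply/esym/seteqP; split=> // q _.
by exists 1 => //; rewrite prime_compl1.
Qed.

Fact zariski_openI : setI_closed zariski_open.
Proof.
move=> _ _ [E ->] [F ->].
exists [set c | exists a b, [/\ E a, F b & c = a * b]]; apply/seteqP; split=> q.
  move=> [[a Ea aq] [b Fb bq]]; exists (a * b); first by exists a, b.
  by rewrite prime_idealrM negb_or aq.
move=> [_ [a [b [Ea Fb ->]]]]; rewrite prime_idealrM negb_or => /andP[aq bq].
by split; [exists a | exists b].
Qed.

Fact zariski_open_bigU (I : Type) (f : I -> set (Spec A)) :
  (forall i, zariski_open (f i)) -> zariski_open (\bigcup_i f i).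
Proof.
move=> /choice[E fE]; exists (\bigcup_i E i); apply/seteqP; split=> q.
  by move=> [i _]; rewrite fE => -[a Ea aq]; exists a => //; exists i.
by move=> [a [i _ Ea] aq]; exists i => //; rewrite fE; exists a.
Qed.

HB.instance Definition _ := isOpenTopological.Build (Spec A)
  zariski_openT zariski_openI zariski_open_bigU.

End Zariski.

Record fps (A : Type) (n : nat) := Fps { fcoeff : 'X_{1..n} -> A }.

Lemma fpsP (A : Type) n (f g : fps A n) : fcoeff f =1 fcoeff g -> f = g.
Proof. by case: f g => [f] [g] /= /funext ->. Qed.

HB.instance Definition _ (A : Type) n := gen_eqMixin (fps A n).
HB.instance Definition _ (A : Type) n := gen_choiceMixin (fps A n).

Section PowerSeries.
Variables (A : comNzRingType) (n : nat).
Implicit Types f g h : fps A n.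

Definition fps_of_mpoly (P : {mpoly A[n]}) : fps A n := Fps (fun m => P@_m).

Definition fps_opp f : fps A n := Fps (fun m => - fcoeff f m).
Definition fps_add f g : fps A n := Fps (fun m => fcoeff f m + fcoeff g m).
Definition fps_mul f g : fps A n := Fps (fun m =>
  \sum_(k : 'X_{1..n < (mdeg m).+1, (mdeg m).+1} | m == (k.1 + k.2)%MM)
    fcoeff f k.1 * fcoeff g k.2).

Fact fps_addA : associative fps_add.
Proof. by move=> f g h; apply: fpsP => m /=; rewrite addrA. Qed.

Fact fps_addC : commutative fps_add.
Proof. by move=> f g; apply: fpsP => m /=; rewrite addrC. Qed.

Fact fps_add0 : left_id (fps_of_mpoly 0) fps_add.
Proof. by move=> f; apply: fpsP => m /=; rewrite mcoeff0 add0r. Qed.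

Fact fps_addN : left_inverse (fps_of_mpoly 0) fps_opp fps_add.
Proof. by move=> f; apply: fpsP => m /=; rewrite mcoeff0 addNr. Qed.

HB.instance Definition _ :=
  GRing.isZmodule.Build (fps A n) fps_addA fps_addC fps_add0 fps_addN.

(* The ring laws are transferred from polynomials through truncation. *)
Definition fps_trunc d f : {mpoly A[n]} :=
  \sum_(m : 'X_{1..n < d}) fcoeff f m *: 'X_[m].

Lemma fps_truncE d f m : (mdeg m < d)%N -> (fps_trunc d f)@_m = fcoeff f m.
Proof.
move=> md; rewrite raddf_sum (bigD1 (BMultinom md)) //= mcoeffZ mcoeffX eqxx.
rewrite mulr1 big1 ?addr0 // => k km; rewrite mcoeffZ mcoeffX.
case: eqP => [e|]; last by rewrite mulr0.
by case/eqP: km; apply: val_inj.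
Qed.

Lemma fps_mulE f g (P Q : {mpoly A[n]}) m :
    (forall k, (mdeg k <= mdeg m)%N -> P@_k = fcoeff f k) ->
    (forall k, (mdeg k <= mdeg m)%N -> Q@_k = fcoeff g k) ->
  fcoeff (fps_mul f g) m = (P * Q)@_m.
Proof.
move=> eP eQ; rewrite mcoeffM; apply: eq_bigr => k _.
by rewrite eP ?eQ // -ltnS bmdeg.
Qed.

Lemma fps_mul_trunc d f g m : (mdeg m < d)%N ->
  fcoeff (fps_mul f g) m = (fps_trunc d f * fps_trunc d g)@_m.
Proof.
by move=> md; apply: fps_mulE => k km; rewrite fps_truncE // (leq_ltn_trans km).
Qed.

Fact fps_mulA : associative fps_mul.
Proof.
move=> f g h; apply: fpsP => m; pose T := fps_trunc (mdeg m).+1.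
have TE f' k : (mdeg k <= mdeg m)%N -> (T f')@_k = fcoeff f' k.
  by move=> km; rewrite fps_truncE // ltnS.
have TM f' g' k : (mdeg k <= mdeg m)%N -> (T f' * T g')@_k = fcoeff (fps_mul f' g') k.
  by move=> km; rewrite -fps_mul_trunc // ltnS.
transitivity (T f * T g * T h)@_m.
  by rewrite -mulrA; apply: fps_mulE => k km; [apply: TE | apply: TM].
by apply/esym/fps_mulE => k km; [apply: TM | apply: TE].
Qed.

Fact fps_mulC : commutative fps_mul.
Proof.
by move=> f g; apply: fpsP => m; rewrite !(@fps_mul_trunc (mdeg m).+1) // mulrC.
Qed.

Fact fps_mul1 : left_id (fps_of_mpoly 1) fps_mul.
Proof.
move=> f; apply: fpsP => m.
rewrite (@fps_mulE _ _ 1 (fps_trunc (mdeg m).+1 f)) //.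
  by rewrite mul1r fps_truncE.
by move=> k km; rewrite fps_truncE.
Qed.

Fact fps_mulDl : left_distributive fps_mul fps_add.
Proof.
move=> f g h; apply: fpsP => m; rewrite /= -big_split /=.
by apply: eq_bigr => k _; rewrite mulrDl.
Qed.

Fact fps_one_neq0 : fps_of_mpoly 1 != fps_of_mpoly 0.
Proof.
apply/eqP => /(congr1 (fun f => fcoeff f 0%MM))/eqP.
by rewrite /= mcoeff1 mcoeff0 eqxx oner_eq0.
Qed.

HB.instance Definition _ := GRing.Zmodule_isComNzRing.Build (fps A n)
  fps_mulA fps_mulC fps_mul1 fps_mulDl fps_one_neq0.

Fact fps_of_mpoly_zmod_morphism : zmod_morphism fps_of_mpoly.
Proof. by move=> P Q; apply: fpsP => m; rewrite /= mcoeffB. Qed.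

Fact fps_of_mpoly_monoid_morphism : monoid_morphism fps_of_mpoly.
Proof. by split=> // P Q; apply: fpsP => m; rewrite /= mcoeffM. Qed.

HB.instance Definition _ := GRing.isZmodMorphism.Build {mpoly A[n]} (fps A n)
  fps_of_mpoly fps_of_mpoly_zmod_morphism.
HB.instance Definition _ := GRing.isMonoidMorphism.Build {mpoly A[n]} (fps A n)
  fps_of_mpoly fps_of_mpoly_monoid_morphism.

Definition fpsC : {rmorphism A -> fps A n} := fps_of_mpoly \o @mpolyC n A.

Definition fpsX (i : 'I_n) : fps A n := fps_of_mpoly 'X_i.

End PowerSeries.

Section Ideals.
Variable R : comPzRingType.

Definition is_ideal (I : {pred R}) : Prop :=
  submod_closed (I : {pred R^o}).

Definition ideal_gen (G : set R) : {pred R} := @span R R^o G.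

Definition ideal_pow (I : {pred R}) (m : nat) : {pred R} :=
  ideal_gen [set r | exists s : 'I_m -> R, (forall i, s i \in I) /\
                                           r = \prod_i s i].

Definition noetherian : Prop := forall I : {pred R}, is_ideal I ->
  exists s : seq R, I =i ideal_gen [set` s].

Definition fin_gen (M : lmodType R) : Prop :=
  exists s : seq M, forall v, v \in span [set` s].

(* Generators of the submodule IM of M. *)
Definition ideal_mul (I : {pred R}) (M : lmodType R) : set M :=
  [set w | exists a v, a \in I /\ w = a *: v].
Arguments ideal_mul : clear implicits.

Lemma ideal_powS I m : {subset ideal_pow I m.+1 <= ideal_pow I m}.
Proof.
apply: (@sub_span R R^o) => _ [s [sI ->]]; rewrite big_ord_recl.
apply: (@spanZ R R^o); apply: mem_span.
by exists (fun i => s (fintype.lift ord0 i)).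
Qed.

Lemma ideal_mulS I m (M : lmodType R) :
  {subset span (ideal_mul (ideal_pow I m.+1) M) <=
          span (ideal_mul (ideal_pow I m) M)}.
Proof.
apply: sub_span => _ [a [v [aI ->]]]; apply: mem_span.
by exists a, v; split=> //; apply: ideal_powS.
Qed.

End Ideals.
Arguments ideal_mul {R} I M.

Definition prime_chain (A : comNzRingType) (l : nat) (q : 'I_l.+1 -> Spec A) :=
  forall i j : 'I_l.+1, (i < j)%N ->
    {subset prime_set (q i) <= prime_set (q j)} /\
    ~ {subset prime_set (q j) <= prime_set (q i)}.

Definition krull_dim_is (A : comNzRingType) (d : nat) : Prop :=
  (exists q : 'I_d.+1 -> Spec A, prime_chain q) /\
  (forall l (q : 'I_l.+1 -> Spec A), prime_chain q -> (l <= d)%N).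

Section InverseLimit.
Variables (K : pzRingType) (T : nat -> lmodType K).

Definition dprod : Type := forall m, T m.
HB.instance Definition _ := Choice.on dprod.

Implicit Types x y z : dprod.

Definition dprod_add x y : dprod := fun m => x m + y m.
Definition dprod_opp x : dprod := fun m => - x m.
Definition dprod_zero : dprod := fun m => 0.
Definition dprod_scale (a : K) x : dprod := fun m => a *: x m.

Fact dprod_addA : associative dprod_add.
Proof. by move=> x y z; apply: functional_extensionality_dep => m; apply: addrA. Qed.

Fact dprod_addC : commutative dprod_add.
Proof. by move=> x y; apply: functional_extensionality_dep => m; apply: addrC. Qed.

Fact dprod_add0 : left_id dprod_zero dprod_add.
Proof. by move=> x; apply: functional_extensionality_dep => m; apply: add0r. Qed.

Fact dprod_addN : left_inverse dprod_zero dprod_opp dprod_add.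
Proof. by move=> x; apply: functional_extensionality_dep => m; apply: addNr. Qed.

HB.instance Definition _ :=
  GRing.isZmodule.Build dprod dprod_addA dprod_addC dprod_add0 dprod_addN.

Fact dprod_scaleA a b x :
  dprod_scale a (dprod_scale b x) = dprod_scale (a * b) x.
Proof. by apply: functional_extensionality_dep => m; apply: scalerA. Qed.

Fact dprod_scale1 : left_id 1 dprod_scale.
Proof. by move=> x; apply: functional_extensionality_dep => m; apply: scale1r. Qed.

Fact dprod_scaleDr : right_distributive dprod_scale +%R.
Proof. by move=> a x y; apply: functional_extensionality_dep => m; apply: scalerDr. Qed.

Fact dprod_scaleDl x : {morph dprod_scale^~ x : a b / a + b >-> a + b}.
Proof. by move=> a b; apply: functional_extensionality_dep => m; apply: scalerDl. Qed.

HB.instance Definition _ := GRing.Zmodule_isLmodule.Build K dprod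
  dprod_scaleA dprod_scale1 dprod_scaleDr dprod_scaleDl.

Variable t : forall m, {linear T m.+1 -> T m}.

Definition compatible : {pred dprod} :=
  fun x => `[< forall m, t m (x m.+1) = x m >].

Fact compatible_submod_closed : submod_closed compatible.
Proof.
split; first by apply/asboolP => m; rewrite linear0.
move=> a x y /asboolP tx /asboolP ty; apply/asboolP => m.
by rewrite [LHS]linearP tx ty.
Qed.

HB.instance Definition _ :=
  GRing.isSubmodClosed.Build K dprod compatible compatible_submod_closed.

Record invlim := InvLim { invlim_val : dprod; _ : invlim_val \in compatible }.
HB.instance Definition _ := [isSub for invlim_val].
HB.instance Definition _ := [Choice of invlim by <:].
HB.instance Definition _ := [SubChoice_isSubLmodule of invlim by <:].

End InverseLimit.

(* None stands for infinite dimension; Vector.axiom d V holds a linear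
   bijection between V and the row vectors of length d. *)
Definition dim_option (K : fieldType) (V : lmodType K) : option nat :=
  if pselect (exists d, inhabited (Vector.axiom d V)) is left h
  then Some (projT1 (cid h)) else None.

Definition leq_option (a b : option nat) : bool :=
  match a, b with
  | _, None => true
  | None, Some _ => false
  | Some d, Some e => (d <= e)%N
  end.

Section CompletedFibre.
Variables (A : comNzRingType) (n : nat) (M : lmodType (fps A n)) (p : Spec A).
Local Notation R := (fps A n).

Definition fps_ideal : {pred R} := ideal_gen (range (@fpsX A n)).

(* M / <x>^m M *)
Definition jet (m : nat) : lmodType R :=
  quotmod (ideal_mul (ideal_pow fps_ideal m) M).

Definition jet_proj (m : nat) : {linear jet m.+1 -> jet m} :=
  quotmod_proj (@ideal_mulS R fps_ideal m M).

Definition jet_fibre (m : nat) : lmodType (residue_field p) :=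
  tensor (to_residue p) (restr (fpsC A n) (jet m)).

Definition jet_fibre_proj (m : nat) :
    {linear jet_fibre m.+1 -> jet_fibre m} :=
  tensor_map (to_residue p)
    (restr_map (fpsC A n) (jet_proj m) :
       {linear restr (fpsC A n) (jet m.+1) -> restr (fpsC A n) (jet m)}).

Definition completed_fibre : lmodType (residue_field p) :=
  invlim jet_fibre_proj.

Definition completed_fibre_dim : option nat := dim_option completed_fibre.

End CompletedFibre.

(* D is C modulo an ideal of square zero. *)
Definition formally_etale (S B : comPzRingType) (phi : {rmorphism S -> B}) :=
  forall (C D : comPzRingType) (pi : {rmorphism C -> D})
      (g : {rmorphism S -> C}) (h : {rmorphism B -> D}),
    (forall d, exists c, pi c = d) ->
    (forall c c', pi c = 0 -> pi c' = 0 -> c * c' = 0) ->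
    (forall s, h (phi s) = pi (g s)) ->
  exists! k : B -> C, [/\ zmod_morphism k, monoid_morphism k,
    forall s, k (phi s) = g s & forall b, pi (k b) = h b].

Definition finitely_presented (S : comNzRingType) (B : comPzRingType)
    (phi : {rmorphism S -> B}) :=
  exists m (theta : {rmorphism {mpoly S[m]} -> B}) (s : seq {mpoly S[m]}),
    [/\ forall a, theta a%:MP = phi a,
        forall b, exists P, theta P = b
      & forall P, theta P = 0 <-> P \in ideal_gen [set` s]].

Definition etale (S : comNzRingType) (B : comPzRingType)
    (phi : {rmorphism S -> B}) :=
  finitely_presented phi /\ formally_etale phi.

Section Algebraic.
Variables (A : comNzRingType) (n : nat).

(* phi induces an isomorphism A[x]/<x> -> B/<x>B. *)
Definition iso_mod_x (B : comPzRingType)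
    (phi : {rmorphism {mpoly A[n]} -> B}) :=
  let xB := ideal_gen (range (fun i : 'I_n => phi 'X_i)) in
  (forall P, phi P \in xB ->
     P \in ideal_gen (range (fun i : 'I_n => 'X_i : {mpoly A[n]}))) /\
  (forall b, exists P, b - phi P \in xB).

(* f lies in A<x>, viewed inside A[[x]]: it is the image of an element of some
   B in the direct system defining the Henselization. The canonical map from B
   to A[[x]] = lim A[x]/<x>^m = lim B/<x>^m B is the only morphism psi of
   A[x]-algebras from B to A[[x]]. *)
Definition algebraic_fps (f : fps A n) : Prop :=
  exists (B : comPzRingType) (phi : {rmorphism {mpoly A[n]} -> B})
         (psi : {rmorphism B -> fps A n}) (b : B),
    [/\ etale phi, iso_mod_x phi,
        forall P, psi (phi P) = fps_of_mpoly P & f = psi b].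

(* T acts on column vectors, R^p -> R^q. *)
Definition algebraically_presented (M : lmodType (fps A n)) : Prop :=
  exists p q (T : 'M[fps A n]_(q, p)) (pi : {linear 'cV[fps A n]_q -> M}),
    [/\ forall i j, algebraic_fps (T i j),
        forall v, exists u, pi u = v
      & forall u, pi u = 0 <-> exists w : 'cV_p, u = T *m w].

End Algebraic.

(* An idealr is a proper ideal. *)
Definition maximal_ideal (A : comNzRingType) (m : idealr A) : Prop :=
  forall J : idealr A, {subset (m : {pred A}) <= (J : {pred A})} ->
                       {subset (J : {pred A}) <= (m : {pred A})}.

Definition local_ring (A : comNzRingType) (m : idealr A) : Prop :=
  maximal_ideal m /\
  forall J : idealr A, maximal_ideal J -> (J : {pred A}) =i (m : {pred A}).

(* A -> lim A / I^k is bijective. *)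
Definition adically_complete (A : comNzRingType) (I : {pred A}) : Prop :=
  (forall a, (forall k, a \in ideal_pow I k) -> a = 0) /\
  (forall u : nat -> A, (forall k, u k.+1 - u k \in ideal_pow I k) ->
     exists a, forall k, a - u k \in ideal_pow I k).

Definition contains_field (A : comNzRingType) : Prop :=
  exists (F : fieldType) (f : {rmorphism F -> A}), injective f.

Definition complete_local_with_field (A : comNzRingType) : Prop :=
  exists m : idealr A,
    [/\ local_ring m, adically_complete (m : {pred A}) & contains_field A].

(* Main.v *)
(* Write P_m(q) for M/<x>^m M (x) k(q) and d_m(q) for its dimension, so that the
   completed fibre at q is the limit of the surjections P_(m+1)(q) -> P_m(q).
   If one of these is injective, then <x>^m P_(m+1)(q) = 0, which passes to all
   larger m, so the limit is P_m(q). Hence d_0(q), d_1(q), ... increases strictly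
   until it becomes constant, and the completed fibre at q has dimension at most
   d as soon as d_(d+1)(q) <= d. As M/<x>^(d+1) M is finitely generated over A,
   this condition is open in q. *)
Require Import Defs.
From HB Require Import structures.
From mathcomp Require Import all_boot all_order all_algebra.
From mathcomp Require Import generic_quotient ring_quotient.
From mathcomp Require Import boolp classical_sets topology.
From mathcomp.multinomials Require Import freeg mpoly.

Set Implicit Arguments.
Unset Strict Implicit.
Unset Printing Implicit Defensive.

Import Defs GRing.Theory.

Local Open Scope classical_set_scope.
Local Open Scope ring_scope.
Local Open Scope quotient_scope.

(** * Finite families that span or are independent *)

Definition spans (K : pzRingType) (V : lmodType K) (I : finType) (f : I -> V) :=
  forall v, exists c : I -> K, v = \sum_i c i *: f i.

Definition lin_indep (K : pzRingType) (V : lmodType K) (I : finType)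
    (f : I -> V) :=
  forall c : I -> K, \sum_i c i *: f i = 0 -> forall i, c i = 0.

Section Spanning.
Variables (K : pzRingType) (V : lmodType K).

Lemma spans_comp (W : lmodType K) (h : {linear V -> W}) (I : finType)
    (f : I -> V) :
  (forall w, exists v, h v = w) -> spans f -> spans (h \o f).
Proof.
move=> hsurj fs w; have [v <-] := hsurj w; have [c ->] := fs v.
by exists c; rewrite linear_sum; apply: eq_bigr => i _; rewrite linearZ.
Qed.

Lemma lin_comb_trans (I J : finType) (f : I -> V) (g : J -> V) (b : I -> K) :
  (forall i, exists c : J -> K, f i = \sum_j c j *: g j) ->
  exists c : J -> K, \sum_i b i *: f i = \sum_j c j *: g j.
Proof.
move=> /choice[c fE]; exists (fun j => \sum_i b i * c i j).
under eq_bigr do rewrite fE scaler_sumr.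
rewrite exchange_big; apply: eq_bigr => j _; rewrite scaler_suml.
by apply: eq_bigr => i _; rewrite scalerA.
Qed.

Lemma spans_trans (I J : finType) (f : I -> V) (g : J -> V) :
  spans f -> (forall i, exists c : J -> K, f i = \sum_j c j *: g j) -> spans g.
Proof. by move=> fs fg v; have [b ->] := fs v; apply: lin_comb_trans. Qed.

Lemma lin_comb1 (I : finType) (f : I -> V) i :
  f i = \sum_j (j == i)%:R *: f j.
Proof.
rewrite (bigD1 i) //= eqxx scale1r big1 ?addr0 // => j /negPf->.
by rewrite scale0r.
Qed.

Lemma spans_seq (s : seq V) : (forall v, v \in span [set` s]) ->
  spans (fun i : 'I_(size s) => s`_i).
Proof.
move=> ss v; have /spanP[k [c [g [gs ->]]]] := ss v.
apply: lin_comb_trans => i; have gis : g i \in s := gs i.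
have lt_i : (index (g i) s < size s)%N by rewrite index_mem.
rewrite -(nth_index 0 gis).
by eexists; exact: (lin_comb1 (fun i : 'I_(size s) => s`_i) (Ordinal lt_i)).
Qed.

Lemma spans_enum (I : finType) (f : I -> V) :
  spans f -> spans (fun i : 'I_#|I| => f (enum_val i)).
Proof.
move=> fs; apply: (spans_trans fs) => i; rewrite -{1}[i]enum_rankK.
eexists; exact: (lin_comb1 (fun i : 'I_#|I| => f (enum_val i))).
Qed.

(** Each [f i] is a combination of finitely many elements of [G]; the elements that occur, over all
    [i], form the family [g]. *)
Lemma spans_span (I : finType) (f : I -> V) (G : set V) : spans f ->
  (forall i, f i \in span G) ->
  exists d (g : 'I_d -> V), (forall i, G (g i)) /\ spans g.
Proof.
move=> fs fG.
have /choice[t tE] i : exists t : {k & ('I_k -> K) * ('I_k -> V)}%type,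
    (forall j, G ((tagged t).2 j)) /\ f i = \sum_j (tagged t).1 j *: (tagged t).2 j.
  have /spanP[k [c [g gE]]] := fG i.
  by exists (Tagged (fun k => ('I_k -> K) * ('I_k -> V))%type (c, g)).
pose J : finType := {i : I & 'I_(tag (t i))}.
pose h (u : J) := (tagged (t (tag u))).2 (tagged u).
have hs : spans h.
  move=> v; have [b ->] := fs v.
  exists (fun u : J => b (tag u) * (tagged (t (tag u))).1 (tagged u)).
  rewrite -(sig_big_dep (fun=> true) (fun _ _ => true)
    (fun i j => (b i * (tagged (t i)).1 j) *: (tagged (t i)).2 j)) /=.
  apply: eq_bigr => i _; have [_ ->] := tE i; rewrite scaler_sumr.
  by apply: eq_bigr => j _; rewrite scalerA.
exists #|J|, (fun i => h (enum_val i)); split; last exact: spans_enum.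
by move=> i; apply: (tE _).1.
Qed.

End Spanning.

(** * Bases and dimension over a field *)

Section FiniteDimension.
Variables (K : fieldType) (V : lmodType K).

(** Over a field the relation can be solved for [f i0], which makes this member redundant. *)
Lemma spans_drop d (f : 'I_d.+1 -> V) (c : 'I_d.+1 -> K) i0 :
  spans f -> \sum_i c i *: f i = 0 -> c i0 != 0 ->
  spans (fun j => f (fintype.lift i0 j)).
Proof.
move=> fs /eqP; rewrite (bigD1_ord i0) //= addrC addr_eq0 => /eqP c0 ci0.
apply: (spans_trans fs) => i; case: (unliftP i0 i) => [j ->|->].
  exists (fun k => (k == j)%:R); rewrite (bigD1 j) //= eqxx scale1r.
  by rewrite big1 ?addr0 // => k /negPf->; rewrite scale0r.
exists (fun j => - (c i0)^-1 * c (fintype.lift i0 j)).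
under eq_bigr do rewrite -scalerA.
by rewrite -scaler_sumr c0 scaleNr scalerN opprK scalerA mulVf ?scale1r.
Qed.

(** Members are deleted as long as there is a nontrivial relation. Carrying [G] along allows a basis
    to be taken inside a prescribed generating set. *)
Lemma spans_lin_indep (G : set V) d (f : 'I_d -> V) :
  (forall i, G (f i)) -> spans f ->
  exists e (g : 'I_e -> V),
    [/\ (e <= d)%N, forall i, G (g i), spans g & lin_indep g].
Proof.
elim: d f => [|d IH] f Gf fs; first by exists 0, f; split=> // c _ [].
have [fi|/existsNP[c /not_implyP[c0 /existsNP[i0 /eqP ci0]]]] :=
  pselect (lin_indep f); first by exists d.+1, f.
have [//|e [g [ed Gg gs gi]]] := IH _ _ (spans_drop fs c0 ci0).
by exists e, g; split=> //; apply: leq_trans ed _.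
Qed.

(** Independence of [g] gives the matrix [C] of its coordinates with respect to [f] a zero left
    kernel. So the rank of [C] is [e], and it is at most the number [d] of columns. *)
Lemma lin_indep_leq d (f : 'I_d -> V) e (g : 'I_e -> V) :
  spans f -> lin_indep g -> (e <= d)%N.
Proof.
move=> fs gi.
have /choice[c gE] i : exists c, g i = \sum_j c j *: f j by exact: fs.
pose C := \matrix_(i < e, j < d) c i j.
have kerC (u : 'rV_e) : u *m C = 0 -> u = 0.
  move=> uC; apply/rowP => i; rewrite mxE; apply: (gi (u 0)).
  under eq_bigr do rewrite gE scaler_sumr.
  rewrite exchange_big big1 // => j _ /=.
  transitivity ((u *m C) 0 j *: f j); last by rewrite uC mxE scale0r.
  rewrite mxE scaler_suml; apply: eq_bigr => k _.
  by rewrite mxE scalerA.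
suff /eqP <- : row_free C by apply: rank_leq_col.
rewrite -kermx_eq0; apply/eqP/row_matrixP => i.
by rewrite row0; apply: kerC; apply/sub_kermxP; exact: row_sub.
Qed.

(** Coordinates are picked by choice; independence makes them unique, and uniqueness makes them
    linear in the vector. *)
Lemma lin_indep_spans_axiom d (f : 'I_d -> V) :
  spans f -> lin_indep f -> Vector.axiom d V.
Proof.
move=> fs fi.
have /choice[c cE] v : exists c : 'rV[K]_d, v = \sum_i c 0 i *: f i.
  have [c ->] := fs v.
  by exists (\row_i c i); apply: eq_bigr => i _; rewrite mxE.
have c_uniq v (b : 'rV_d) : v = \sum_i b 0 i *: f i -> c v = b.
  move=> vE; apply/rowP => i; apply/eqP; rewrite -subr_eq0; apply/eqP.
  apply: (fi (fun i => c v 0 i - b 0 i)).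
  under eq_bigr do rewrite scalerBl.
  by rewrite sumrB -cE -vE subrr.
exists c.
  move=> a u v; apply: c_uniq; rewrite {1}[u]cE {1}[v]cE scaler_sumr -big_split.
  by apply: eq_bigr => i _; rewrite !mxE scalerDl scalerA.
exists (fun b : 'rV_d => \sum_i b 0 i *: f i) => [v|b]; first by rewrite -cE.
exact: c_uniq.
Qed.

Lemma axiom_spans d : Vector.axiom d V ->
  exists f : 'I_d -> V, spans f /\ lin_indep f.
Proof.
move=> [h hlin [g hK gK]].
pose H := GRing.isLinear.Build _ _ _ _ h hlin.
pose hL : {linear V -> 'rV[K]_d} := HB.pack h H.
have hsum (c : 'I_d -> K) (f : 'I_d -> V) :
    h (\sum_i c i *: f i) = \sum_i c i *: h (f i).
  by rewrite -[h]/(hL : _ -> _) linear_sum; apply: eq_bigr => i _; rewrite linearZ.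
exists (fun i => g (delta_mx 0 i)); split.
  move=> v; exists (h v 0); apply: (can_inj hK); rewrite hsum.
  by under eq_bigr do rewrite gK; rewrite -row_sum_delta.
move=> c /(congr1 h); rewrite hsum -[h 0]/(hL 0) linear0.
under eq_bigr do rewrite gK.
move=> c0 i; move/rowP/(_ i): c0; rewrite summxE (bigD1 i) //= !mxE !eqxx mulr1.
rewrite big1 ?addr0 // => j ji; rewrite !mxE eqxx eq_sym (negPf ji) mulr0 //.
Qed.

(** A basis extracted from [f] rules out the value [None]. The number picked by [dim_option] is the
    length of some basis, hence at most [d]. *)
Lemma dim_option_leq d (f : 'I_d -> V) :
  spans f -> exists2 e, dim_option V = Some e & (e <= d)%N.
Proof.
move=> fs; rewrite /dim_option; case: pselect => [h|nh]; last first.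
  have [e [g [_ _ gs gi]]] := @spans_lin_indep setT _ f (fun=> I) fs.
  by case: nh; exists e; split; apply: lin_indep_spans_axiom gs gi.
case: cid => e [/axiom_spans[g [_ gi]]] /=.
by exists e => //; apply: lin_indep_leq fs gi.
Qed.

Lemma dim_option_spans d : dim_option V = Some d ->
  exists f : 'I_d -> V, spans f.
Proof.
rewrite /dim_option; case: pselect => // h [].
by case: cid => e [/axiom_spans[f [fs _]]] /= <-; exists f.
Qed.

End FiniteDimension.

(** * Tensor products: generators and universal property *)

Section TensorProduct.
Variables (A : comPzRingType) (B : comNzRingType) (f : {rmorphism A -> B}).

Definition tensor1 (N : lmodType A) (u : N) : tensor f N :=
  tensor_pi f (tensor_sym u 1).

Section Object.
Variable N : lmodType A.
Implicit Types (u v : N) (b : B).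

Lemma tensor_piB : {morph @tensor_pi A B f N : x y / x - y}.
Proof. exact: quotmod_piB. Qed.

Lemma tensor_pi0 : tensor_pi f (0 : {freeg (N * B)%type / int}) = 0.
Proof. by rewrite -(subrr 0) tensor_piB subrr. Qed.

Lemma tensor_pi_eq0 (x : {freeg (N * B)%type / int}) :
  tensor_rel f x -> tensor_pi f x = 0.
Proof.
by move=> fx; rewrite -tensor_pi0; apply/tensor_eqP; rewrite subr0; exact: mem_span.
Qed.

Lemma tensor1D u v : tensor1 (u + v) = tensor1 u + tensor1 v.
Proof.
apply/eqP; rewrite -subr_eq0 opprD addrA; apply/eqP.
by have := tensor_pi_eq0 (TensorDl f u v 1); rewrite !tensor_piB.
Qed.

Lemma tensor1_sym u b : tensor_pi f (tensor_sym u b) = b *: tensor1 u.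
Proof.
by rewrite -[b *: _]tensor_piZ /tensor_act fgpushU /= mulr1.
Qed.

Lemma tensor1Z a u : tensor1 (a *: u) = f a *: tensor1 u.
Proof.
apply/eqP; rewrite -subr_eq0; apply/eqP.
have := tensor_pi_eq0 (TensorZ f a u 1).
by rewrite tensor_piB !tensor1_sym scale1r mulr1.
Qed.

Lemma tensor1_0 : tensor1 (0 : N) = 0.
Proof. by rewrite -(scale0r (0 : N)) tensor1Z rmorph0 scale0r. Qed.

Lemma tensor1_sum (I : finType) (F : I -> N) :
  tensor1 (\sum_i F i) = \sum_i tensor1 (F i).
Proof. exact: (big_morph (@tensor1 N) tensor1D tensor1_0). Qed.

Lemma tensor_piU k u b :
  tensor_pi f << k *g (u, b) >> = (b *: tensor1 u) *~ k.
Proof.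
have -> : << k *g (u, b) >> = k *: tensor_sym u b.
  by apply/eqP/freeg_eqP => r; rewrite coeffZ !coeffU mul1r.
rewrite -tensor1_sym; elim: k => [|k IH|k IH].
- by rewrite scale0r tensor_pi0.
- by rewrite intS scalerDl scale1r mulrzDr tensor_piD IH.
- by rewrite -addn1 PoszD opprD scalerDl scaleN1r mulrzDr tensor_piB IH.
Qed.

Lemma tensor1_span (x : tensor f N) : x \in span (range (@tensor1 N)).
Proof.
rewrite -[x]tensor_reprK; elim/freeg_ind_dom0: (tensor_repr x).
  by rewrite tensor_pi0 span0.
move=> k [u b] D _ _ IH; rewrite tensor_piD spanD // tensor_piU.
by apply: rpredMz; apply: spanZ; apply: mem_span; exists u.
Qed.

Lemma tensor1_spans (I : finType) (g : I -> N) :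
  spans g -> spans (fun i => tensor1 (g i)).
Proof.
move=> gs x; have /spanP[k [c [h [hE ->]]]] := tensor1_span x.
have /choice[u {}hE] j : exists u, tensor1 u = h j.
  by have [u _ uE] := hE j; exists u.
have /choice[b bE] j : exists b : I -> A, u j = \sum_i b i *: g i by exact: gs.
exists (fun i => \sum_j c j * f (b j i)).
under [RHS]eq_bigr do rewrite scaler_suml.
rewrite exchange_big; apply: eq_bigr => j _; rewrite -hE bE tensor1_sum scaler_sumr.
by apply: eq_bigr => i _; rewrite tensor1Z scalerA.
Qed.

Section Lift.
Variables (Q : lmodType B) (h : N -> Q).
Hypotheses (hD : {morph h : u v / u + v}) (hZ : forall a u, h (a *: u) = f a *: h u).

(** The pair (u, b) goes to b h(u). Here [zmodule Q] is [Q] seen as a module over the integers, the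
    coefficients of the free group. *)
Definition tensor_lift_fg (x : {freeg (N * B)%type / int}) : Q :=
  fglift (fun p : N * B => (p.2 *: h p.1 : zmodule Q)) x.

Let liftB : {morph tensor_lift_fg : x y / x - y}.
Proof.
exact: (@lift_is_additive _ _ (zmodule Q : lmodType int)
  (fun p : N * B => p.2 *: h p.1)).
Qed.

Let lift0 : tensor_lift_fg 0 = 0.
Proof. by rewrite -(subrr 0) liftB subrr. Qed.

Let liftD : {morph tensor_lift_fg : x y / x + y}.
Proof.
by move=> x y; rewrite -{1}[y]opprK liftB -[- y]sub0r liftB lift0 sub0r opprK.
Qed.

Let liftU u b k : tensor_lift_fg << k *g (u, b) >> = (b *: h u) *~ k.
Proof. by rewrite /tensor_lift_fg liftU. Qed.

Let lift_rel x : tensor_rel f x -> tensor_lift_fg x = 0.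
Proof.
case=> [u u' b|u b b'|a u b]; rewrite !liftB !liftU /= !mulr1z.
- by rewrite hD scalerDr addrAC addrK subrr.
- by rewrite scalerDl addrAC addrK subrr.
- by rewrite hZ scalerA mulrC subrr.
Qed.

Let lift_span x : x \in span (@tensor_rel A B f N) -> tensor_lift_fg x = 0.
Proof.
move=> /spanP[k [c [g [gE ->]]]].
rewrite (big_morph _ liftD lift0) big1 // => i _.
suff E (m : int) y : tensor_lift_fg (m *: y) = tensor_lift_fg y *~ m.
  by rewrite E lift_rel // mul0rz.
elim: m => [|m IH|m IH].
- by rewrite scale0r lift0.
- by rewrite intS scalerDl scale1r liftD IH mulrzDr.
- by rewrite -addn1 PoszD opprD scalerDl scaleN1r liftB IH mulrzDr.
Qed.

Definition tensor_lift (x : tensor f N) : Q := tensor_lift_fg (tensor_repr x).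

Let tensor_liftE x : tensor_lift (tensor_pi f x) = tensor_lift_fg x.
Proof.
apply/eqP; rewrite -subr_eq0 -liftB; apply/eqP/lift_span/tensor_eqP.
exact: tensor_reprK.
Qed.

Lemma tensor_lift1 u : tensor_lift (tensor1 u) = h u.
Proof. by rewrite tensor_liftE liftU scale1r. Qed.

Fact tensor_lift_linear : linear tensor_lift.
Proof.
move=> c x y; rewrite -[x]tensor_reprK -[y]tensor_reprK.
rewrite -[c *: _]tensor_piZ -tensor_piD !tensor_liftE liftD; congr (_ + _).
elim/freeg_ind_dom0: (tensor_repr x) => [|k [u b] D _ _ IH].
  by rewrite /tensor_act fgpush0 lift0 scaler0.
move: IH; rewrite /tensor_act fgpushD fgpushU !liftD !liftU /= scalerDr => ->.
by rewrite -scalerA scalerMzr.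
Qed.

End Lift.

(** The universal property of base change. It controls relations in a tensor product: the linear map
    [H] transports them to [Q], where they can be read off. *)
Lemma tensor_lift_ex (Q : lmodType B) (h : N -> Q) :
  {morph h : u v / u + v} -> (forall a u, h (a *: u) = f a *: h u) ->
  exists H : {linear tensor f N -> Q}, forall u, H (tensor1 u) = h u.
Proof.
move=> hD hZ.
pose L := GRing.isLinear.Build _ _ _ _ (tensor_lift h) (tensor_lift_linear hD hZ).
exists (HB.pack (tensor_lift h) L : {linear tensor f N -> Q}) => u.
exact: tensor_lift1.
Qed.

End Object.

Lemma tensor_map1 (N N' : lmodType A) (g : {linear N -> N'}) u :
  tensor_map f g (tensor1 u) = tensor1 (g u).
Proof. by rewrite tensor_mapE /tensor_push fgpushU. Qed.

End TensorProduct.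
Arguments tensor1 {A B} f {N} u.

(** * Fibres of a finitely generated A-module as the prime varies *)

Lemma spans_delta (K : pzRingType) s :
  spans (fun i : 'I_s => delta_mx 0 i : 'rV[K]_s).
Proof. by move=> u; exists (u 0); apply: row_sum_delta. Qed.

Lemma lin_indep_delta (K : pzRingType) s :
  lin_indep (fun i : 'I_s => delta_mx 0 i : 'rV[K]_s).
Proof.
move=> c c0 i; move/rowP/(_ i): c0.
rewrite -[c]/(fun i => c i).
have -> : \sum_j c j *: delta_mx 0 j = \row_j c j :> 'rV_s.
  by rewrite [RHS]row_sum_delta; apply: eq_bigr => j _; rewrite mxE.
by rewrite !mxE.
Qed.

(** If a/1 = b/s with b in p, then u a s lies in p for some u outside p; as s is outside p too, a
    lies in p. *)
Lemma to_residue_eq0 (A : comNzRingType) (p : Spec A) a :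
  (to_residue p a == 0) = (a \in prime_set p).
Proof.
rewrite -[to_residue p a]/(residue_pi p (toloc p a)) -(rmorph0 (residue_pi p)).
rewrite -[_ == _]/(\pi_({ideal_quot (@loc_max A p)}) _ ==
  \pi_({ideal_quot (@loc_max A p)}) _).
rewrite -Quotient.idealrBE subr0; apply/idP/idP => [/loc_maxP[x xp]|ap].
  rewrite piE => /eqP/loc_eqP[u up] /= e.
  have : u * (a * sval x.2) \in prime_set p.
    by rewrite e mulr1 prime_idealrM xp orbT.
  by rewrite !prime_idealrM (negPf up) (negPf (svalP x.2)) orbF.
by apply: mem_span; exists a.
Qed.

Section FibreSemicontinuity.
Variables (A : comNzRingType) (N : lmodType A) (s : nat) (g : 'I_s -> N).
Hypothesis gs : spans g.

Let rel (r : 'rV[A]_s) := \sum_i r 0 i *: g i = 0.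

Let relK (p : Spec A) : set 'rV[residue_field p]_s :=
  [set map_mx (to_residue p) r | r in rel].

(** Right exactness of the tensor product. Sending [v] to the class of its reduced coordinates
    modulo reduced relations is semilinear, so it extends to the fibre; there it maps the
    combination with coefficients [u] to the class of [u]. *)
Lemma fibre_relations (p : Spec A) (u : 'rV[residue_field p]_s) :
  \sum_i u 0 i *: tensor1 (to_residue p) (g i) = 0 -> u \in span (@relK p).
Proof.
move=> u0.
have /choice[c cE] v : exists c : 'rV[A]_s, v = \sum_i c 0 i *: g i.
  have [c ->] := gs v.
  by exists (\row_i c i); apply: eq_bigr => i _; rewrite mxE.
pose h (v : N) := quotmod_pi (@relK p) (map_mx (to_residue p) (c v)).
(* Two coordinate rows of one element differ by a relation, so [h] does not depend on the choice
   [c]. *)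
have hE v (r : 'rV_s) : v = \sum_i r 0 i *: g i ->
    h v = quotmod_pi (@relK p) (map_mx (to_residue p) r).
  move=> vE; apply/quotmod_eqP; rewrite -map_mxB; apply: mem_span.
  exists (c v - r) => //; rewrite /rel.
  under eq_bigr do rewrite !mxE scalerBl.
  by rewrite sumrB -cE -vE subrr.
have [v w|a v|H HE] := @tensor_lift_ex _ _ (to_residue p) N _ h.
- rewrite (hE _ (c v + c w)) ?map_mxD ?quotmod_piD //.
  rewrite {1}[v]cE {1}[w]cE -big_split; apply: eq_bigr => i _.
  by rewrite mxE scalerDl.
- rewrite (hE _ (a *: c v)) ?map_mxZ ?quotmod_piZ //.
  rewrite {1}[v]cE scaler_sumr; apply: eq_bigr => i _.
  by rewrite mxE scalerA.
suff : quotmod_pi (@relK p) u = quotmod_pi (@relK p) 0.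
  by move/quotmod_eqP; rewrite subr0.
rewrite {1}(row_sum_delta u) !linear0 -[RHS](linear0 H) -u0 !linear_sum.
apply: eq_bigr => i _; rewrite !linearZ HE (hE _ (delta_mx 0 i)) /=.
  by rewrite map_delta_mx.
rewrite [LHS]lin_comb1; apply: eq_bigr => j _.
by rewrite mxE eqxx eq_sym.
Qed.

(** Some [e] of the generators form a basis of the fibre at p. Their unit vectors and the reduced
    relations together span k(p)^s, so s of these rows, lifted to A, form a matrix with determinant
    outside p. Wherever this determinant is nonzero, the rows still span k(q)^s, and the same [e]
    generators span the fibre at q. *)
Lemma fibre_spans_open (p : Spec A) d (f : 'I_d -> tensor (to_residue p) N) :
  spans f ->
  exists2 a, a \notin prime_set p & exists2 e, (e <= d)%N &
    forall q : Spec A, a \notin prime_set q ->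
      exists h : 'I_e -> tensor (to_residue q) N, spans h.
Proof.
move=> fs; set K := residue_field p.
pose tau i := tensor1 (to_residue p) (g i).
have taus : spans tau by exact: tensor1_spans.
have [i|e [b [_ b_tau bs bi]]] := spans_lin_indep (G := range tau) _ taus.
  by exists i.
have {bi} ed : (e <= d)%N := lin_indep_leq fs bi.
have /choice[sg sgE] i : exists j, tau j = b i by have [j _ <-] := b_tau i; exists j.
pose G : set 'rV[K]_s := fun u => exists2 r : 'rV[A]_s,
  u = map_mx (to_residue p) r & rel r \/ exists i, r = delta_mx 0 (sg i).
have dG l : delta_mx 0 l \in span G.
  have [c cE] := bs (tau l).
  (* Since [c] expresses [tau l] in the basis [b], the row [u] is a relation in the fibre, hence a
     combination of reduced relations over A. *)
  pose u : 'rV[K]_s := delta_mx 0 l - \sum_i c i *: delta_mx 0 (sg i).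
  have uG : u \in span G.
    have : u \in span (@relK p).
      apply: fibre_relations; rewrite -/K.
      under eq_bigr do rewrite !mxE scalerBl summxE scaler_suml.
      rewrite sumrB [X in _ - X]exchange_big /=.
      have -> : \sum_i (true && (i == l))%:R *: tau i = tau l.
        by rewrite [RHS]lin_comb1.
      apply/eqP; rewrite subr_eq0 cE; apply/eqP/eq_bigr => i _.
      rewrite -sgE [in LHS]lin_comb1 scaler_sumr; apply: eq_bigr => j _.
      by rewrite !mxE eqxx scalerA.
    apply: sub_span => _ [r rr <-]; apply: mem_span.
    by exists r; [|left].
  rewrite -[delta_mx 0 l](subrK (\sum_i c i *: delta_mx 0 (sg i))) rpredD //.
  apply: rpred_sum => i _; apply: rpredZ; apply: mem_span.
  exists (delta_mx 0 (sg i)); first by rewrite map_delta_mx.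
  by right; exists i.
(* A basis of K^s is taken inside [G] so that its members lift to rows over A. *)
have [k [b1 [b1G b1s]]] := spans_span (@spans_delta K s) dG.
have [e' [b2 [_ b2G b2s b2i]]] := spans_lin_indep b1G b1s.
have e's : e' = s.
  apply/eqP; rewrite eqn_leq (lin_indep_leq (@spans_delta K s) b2i).
  exact: lin_indep_leq b2s (@lin_indep_delta K s).
subst e'.
have /choice[r rE] i : exists r : 'rV[A]_s, b2 i = map_mx (to_residue p) r /\
    (rel r \/ exists i, r = delta_mx 0 (sg i)).
  by have [r bE rr] := b2G i; exists r.
pose B := \matrix_i r i.
(* The reduction of [B] at p is invertible because its rows [b2] express every unit vector. *)
exists (\det B).
  rewrite -to_residue_eq0 -det_map_mx -unitfE -unitmxE.
  have /choice[c cE] i : exists c : 'I_s -> K, delta_mx 0 i = \sum_j c j *: b2 j.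
    exact: b2s.
  suff : (\matrix_(i, j) c i j) *m map_mx (to_residue p) B = 1%:M.
    by move/mulmx1_unit => [].
  apply/row_matrixP => i; rewrite row1 cE row_mul mulmx_sum_row.
  apply: eq_bigr => j _; rewrite !mxE (rE j).1; congr (_ *: _).
  by apply/rowP => k'; rewrite !mxE.
exists e => // q.
rewrite -to_residue_eq0 -det_map_mx -unitfE -unitmxE => uB.
pose L (w : 'rV[residue_field q]_s) := \sum_i w 0 i *: tensor1 (to_residue q) (g i).
have L_rel w : L (map_mx (to_residue q) w) = tensor1 (to_residue q) (\sum_i w 0 i *: g i).
  by rewrite tensor1_sum; apply: eq_bigr => i _; rewrite mxE tensor1Z.
have delta_sum j : \sum_i (delta_mx 0 j : 'rV[A]_s) 0 i *: g i = g j.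
  by rewrite [RHS]lin_comb1; apply: eq_bigr => i _; rewrite mxE eqxx.
have Ls : spans (fun i => L (map_mx (to_residue q) (r i))).
  move=> x; have [c ->] := tensor1_spans (f := to_residue q) gs x.
  pose w := (\row_i c i) *m invmx (map_mx (to_residue q) B).
  exists (w 0).
  have wE : \row_i c i = \sum_i w 0 i *: map_mx (to_residue q) (r i).
    rewrite -[LHS](mulmxKV uB) -/w mulmx_sum_row; apply: eq_bigr => i _.
    by congr (_ *: _); apply/rowP => k'; rewrite !mxE.
  transitivity (L (\row_i c i)); first by apply: eq_bigr => i _; rewrite mxE.
  rewrite wE /L; under eq_bigr do rewrite summxE scaler_suml.
  rewrite exchange_big; apply: eq_bigr => i _; rewrite scaler_sumr.
  by apply: eq_bigr => j _; rewrite !mxE scalerA.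
exists (fun i => tensor1 (to_residue q) (g (sg i))).
apply: (spans_trans Ls) => i; rewrite L_rel.
(* Under [L] a relation gives zero and a unit vector gives one of the [e] selected generators. *)
have [_ [->|[j ->]]] := rE i.
  by exists (fun=> 0); rewrite tensor1_0 big1 // => j _; rewrite scale0r.
exists (fun j' => (j' == j)%:R); rewrite delta_sum.
exact: (lin_comb1 (fun j' => tensor1 (to_residue q) (g (sg j')))).
Qed.

End FibreSemicontinuity.

(** * Inverse limits of towers of vector spaces or modules *)

Section Tower.
Variables (K : pzRingType) (T : nat -> lmodType K).
Variable t : forall m, {linear T m.+1 -> T m}.

Definition invlim_ev m (x : invlim t) : T m := invlim_val x m.

Fact invlim_ev_linear m : linear (@invlim_ev m).
Proof. by []. Qed.

HB.instance Definition _ m :=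
  GRing.isLinear.Build K (invlim t) (T m) *:%R (@invlim_ev m) (@invlim_ev_linear m).

Lemma invlim_evS m x : t m (invlim_ev m.+1 x) = invlim_ev m x.
Proof. by have /asboolP := valP x; apply. Qed.

End Tower.

(** The element is continued upwards by sections of the transition maps and downwards by the maps
    themselves; the induction shifts the tower by one. *)
Lemma thread_ex (K : pzRingType) (T : nat -> lmodType K)
    (t : forall m, {linear T m.+1 -> T m}) m (y : T m) :
  (forall k z, exists x, t k x = z) ->
  exists2 x : forall k, T k, (forall k, t k (x k.+1) = x k) & x m = y.
Proof.
elim: m T t y => [|m IH] T t y tsurj.
  have sP k : {s | cancel s (t k)}.
    by apply: cid; have /choice[s sK] := tsurj k; exists s.
  exists (fun k => nat_rect T y (fun k z => sval (sP k) z) k) => // k.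
  exact: (svalP (sP k)).
have [x xt xy] := IH (fun k => T k.+1) (fun k => t k.+1) y (fun k => tsurj k.+1).
exists (fun k => match k return T k with 0 => t 0 (x 0) | k.+1 => x k end) => //.
by case.
Qed.

Lemma invlim_ev_surj (K : pzRingType) (T : nat -> lmodType K)
    (t : forall m, {linear T m.+1 -> T m}) m (y : T m) :
  (forall k z, exists x, t k x = z) -> exists x : invlim t, invlim_ev m x = y.
Proof.
move=> /(thread_ex y)[x xt xy].
have xc : (x : dprod T) \in compatible t by apply/asboolP.
by exists (InvLim xc).
Qed.

(** Components below [m] are images of the one at [m]; those above are determined by it through
    injectivity. *)
Lemma invlim_ev_inj (K : pzRingType) (T : nat -> lmodType K)
    (t : forall m, {linear T m.+1 -> T m}) m :
  (forall k, (m <= k)%N -> forall x, t k x = 0 -> x = 0) ->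
  injective (@invlim_ev K T t m).
Proof.
move=> tinj x y xy; apply/val_inj/functional_extensionality_dep => k.
rewrite -[LHS]/(invlim_ev k x) -[RHS]/(invlim_ev k y).
have [km|/ltnW mk] := leqP k m.
  rewrite -(subnK km) addnC in xy.
  elim: (m - k)%N xy => [|l IH]; first by rewrite addn0.
  by rewrite addnS => /(congr1 (t _)); rewrite !invlim_evS.
rewrite -(subnK mk); elim: (k - m)%N => [|l IH] //; rewrite addSn.
apply/eqP; rewrite -subr_eq0; apply/eqP/tinj; first exact: leq_addl.
by rewrite linearB !invlim_evS IH subrr.
Qed.

(* If no transition map were injective, the number of generators would drop at
   each of the d + 1 steps from T (d + 1) down to T 0. *)
Lemma tower_injective_step (K : fieldType) (T : nat -> lmodType K)
    (t : forall m, {linear T m.+1 -> T m}) d e (f : 'I_e -> T d.+1) :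
  (forall m y, exists x, t m x = y) -> (e <= d)%N -> spans f ->
  exists i c (g : 'I_c -> T i),
    [/\ (c <= d)%N, spans g & forall x, t i x = 0 -> x = 0].
Proof.
move=> tsurj; elim: d e f => [|d IH] e f ed fs.
  (* Here [e] is 0, so T 1 is zero and [t 0] is trivially injective. *)
  exists 0, e, (t 0 \o f); split=> //; first exact: spans_comp.
  by move=> x _; have [c ->] := fs x; case: e f ed fs c => // f _ _ c; rewrite big_ord0.
have tfs : spans (t d.+1 \o f) by apply: spans_comp.
have [tinj|] := pselect (forall x, t d.+1 x = 0 -> x = 0).
  by exists d.+1, e, (t d.+1 \o f).
move=> /existsNP[x /not_implyP[tx0 x0]].
have [c xE] := fs x.
have [i ci0] : exists i, c i != 0.
  apply: contrapT => nc; apply: x0; rewrite xE big1 // => i _.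
  have [->|ci] := eqVneq (c i) 0; first by rewrite scale0r.
  by case: nc; exists i.
case: e f ed fs tfs c xE i ci0 => [|e] f ed fs tfs c xE i ci0; first by case: i ci0.
have rel0 : \sum_i c i *: (t d.+1 \o f) i = 0.
  by rewrite -[RHS]tx0 xE linear_sum; apply: eq_bigr => j _; rewrite linearZ.
have [//|j [k [g [kd gs tinj]]]] := IH _ _ _ (spans_drop tfs rel0 ci0).
by exists j, k, g; split=> //; apply: leqW.
Qed.

(** * Order of power series and powers of <x> *)

Section Order.
Variables (A : comNzRingType) (n : nat).
Implicit Types f : fps A n.

(** Subtraction of exponents is truncated, hence the case distinction. Only finitely many
    coefficients matter, so [f] can be replaced by a polynomial. *)
Lemma fcoeff_mulX i f m :
  fcoeff (fpsX A i * f) m = if (0 < m i)%N then fcoeff f (m - U_(i))%MM else 0.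
Proof.
case: ifP => [mi|/negbT]; last first.
  rewrite -eqn0Ngt => /eqP mi; rewrite [LHS]big1 // => k /eqP mE /=.
  rewrite mcoeffX; case: eqP => [ik|]; last by rewrite mul0r.
  have : m i = (k.1 + k.2)%MM i by rewrite -mE.
  by rewrite mi mnmDE -ik mnm1E eqxx.
rewrite -[fcoeff (_ * _) _]/(fcoeff (fps_mul _ _) _).
rewrite (@fps_mulE _ _ _ _ 'X_i (fps_trunc (mdeg m).+1 f)) //; last first.
  by move=> k km; rewrite fps_truncE.
have mcoeffXM (P : {mpoly A[n]}) : ('X_i * P)@_m = P@_(m - U_(i))%MM.
  have mE : (m - U_(i) + U_(i))%MM = m by rewrite submK // lep1mP -lt0n.
  by rewrite mulrC -{1}mE addmC mcoeffMX.
rewrite mcoeffXM fps_truncE //.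
by rewrite ltnS mdegB.
Qed.

Lemma ideal_pow_mul (R : comPzRingType) (I : {pred R}) m a b :
  a \in I -> b \in ideal_pow I m -> a * b \in ideal_pow I m.+1.
Proof.
move=> aI /spanP[k [c [g [gI ->]]]]; rewrite mulr_sumr.
apply: rpred_sum => i _; rewrite -[c i *: _]/(c i * _) mulrCA.
apply: (@spanZ R R^o); apply: mem_span.
have [s [sI ->]] := gI i.
exists (fun j => oapp s a (unlift ord0 j)); split.
  by move=> j; case: (unlift ord0 j) => [j'|] /=.
rewrite big_ord_recl unlift_none; congr (_ * _).
by apply: eq_bigr => j _; rewrite liftK.
Qed.

Lemma fps_idealX i : fpsX A i \in @fps_ideal A n.
Proof. by apply: mem_span; exists i. Qed.

(** By induction on [d]: f is a sum of x_i g_i over the finitely many variables, with the order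
    bound for each g_i lowered by one. *)
Lemma fps_order_ideal_pow d f :
  (forall m, (mdeg m < d)%N -> fcoeff f m = 0) -> f \in ideal_pow (@fps_ideal A n) d.
Proof.
elim: d f => [|d IH] f f0.
  rewrite -[f]mulr1; apply: (@spanZ (fps A n) (fps A n)^o); apply: mem_span.
  by exists (fun=> 0); rewrite big_ord0; split=> // -[].
pose first_var (m : 'X_{1..n}) := [pick j | (0 < m j)%N].
(* Each monomial of f is divided by its first variable. *)
pose g i : fps A n := Fps (fun m =>
  if first_var (m + U_(i))%MM == Some i then fcoeff f (m + U_(i))%MM else 0).
have -> : f = \sum_i fpsX A i * g i.
  have coef_sum (F : 'I_n -> fps A n) m : fcoeff (\sum_i F i) m = \sum_i fcoeff (F i) m.
    by apply: (big_morph (fun h : fps A n => fcoeff h m)) => //=; rewrite mcoeff0.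
  have coefXg i m : fcoeff (fpsX A i * g i) m =
      if first_var m == Some i then fcoeff f m else 0.
    rewrite fcoeff_mulX; case: ifP => [mi|mi] /=.
      by rewrite submK // lep1mP -lt0n.
    rewrite /first_var; case: pickP => // j mj.
    by case: eqP => // -[ji]; rewrite ji mi in mj.
  apply: fpsP => m; rewrite coef_sum; under eq_bigr do rewrite coefXg.
  case iE: (first_var m) => [i|].
    by rewrite (bigD1 i) //= eqxx big1 ?addr0 // => j ji; case: eqP => // -[ij];
      rewrite ij eqxx in ji.
  (* A monomial without a first variable is 1, and the constant term of f vanishes. *)
  rewrite big1 // f0 //; suff -> : m = 0%MM by rewrite mdeg0.
  apply/mnmP => i; rewrite mnm0E; apply/eqP; rewrite eqn0Ngt.
  by move: iE; rewrite /first_var; case: pickP => // m0 _; rewrite m0.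
apply: rpred_sum => i _; apply: ideal_pow_mul; first exact: fps_idealX.
apply: IH => m md /=; case: ifP => // _.
by rewrite f0 // mdegD mdeg1 addn1.
Qed.

Lemma sub_trunc_ideal_pow d f :
  f - fps_of_mpoly (fps_trunc d f) \in ideal_pow (@fps_ideal A n) d.
Proof.
apply: fps_order_ideal_pow => m md.
by rewrite -[LHS]/(fcoeff f m - (fps_trunc d f)@_m) fps_truncE // subrr.
Qed.

End Order.

(** * Jets of M and their fibres *)

Section Jets.
Variables (A : comNzRingType) (n : nat) (M : lmodType (fps A n)).
Local Notation jetA m := (restr (fpsC A n) (jet M m)).
Local Notation powM m := (span (ideal_mul (ideal_pow (@fps_ideal A n) m) M)).

(** Modulo <x>^m a coefficient series may be truncated, so the monomials of degree below [m] times
    the generators of M generate over A. *)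
Lemma jet_spans m : fin_gen M -> exists s (g : 'I_s -> jetA m), spans g.
Proof.
move=> [s /spans_seq ss].
pose J : finType := ('X_{1..n < m} * 'I_(size s))%type.
pose g (u : J) : jetA m := quotmod_pi (ideal_mul (ideal_pow (@fps_ideal A n) m) M)
  (fps_of_mpoly 'X_[u.1] *: s`_u.2).
suff gs : spans g by exists #|J|, (fun i => g (enum_val i)); apply: spans_enum.
move=> x; have [r rE] := ss (quotmod_repr (x : jet M m)).
exists (fun u : J => fcoeff (r u.2) u.1).
rewrite -[LHS](quotmod_reprK (x : jet M m)) rE linear_sum.
rewrite -(pair_big (fun=> true) (fun=> true)
  (fun (a : 'X_{1..n < m}) (l : 'I_(size s)) => fcoeff (r l) a *: g (a, l))) /=.
rewrite exchange_big /=.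
apply: eq_bigr => l _.
transitivity (quotmod_pi (ideal_mul (ideal_pow (@fps_ideal A n) m) M)
    (fps_of_mpoly (fps_trunc m (r l)) *: s`_l)).
  apply/quotmod_eqP; rewrite -scalerBl; apply: mem_span.
  exists (r l - fps_of_mpoly (fps_trunc m (r l))), s`_l; split=> //.
  exact: sub_trunc_ideal_pow.
rewrite raddf_sum scaler_suml linear_sum; apply: eq_bigr => a _.
rewrite -mul_mpolyC.
rewrite [X in X *: _](_ : _ = fpsC A n (fcoeff (r l) a) * fps_of_mpoly 'X_[a]).
  by rewrite -scalerA; exact: quotmod_piZ.
exact: rmorphM.
Qed.

Variable p : Spec A.
Local Notation fibre m := (jet_fibre M p m).

Definition jet1 m (v : M) : fibre m := tensor1 (to_residue p)
  (quotmod_pi (ideal_mul (ideal_pow (@fps_ideal A n) m) M) v : jetA m).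

Lemma jet1D m : {morph jet1 m : u v / u + v}.
Proof. by move=> u v; rewrite /jet1 quotmod_piD tensor1D. Qed.

Lemma jet1Z m a v : jet1 m (fpsC A n a *: v) = to_residue p a *: jet1 m v.
Proof. by rewrite /jet1 quotmod_piZ -tensor1Z. Qed.

Lemma jet1_eq0 m v : v \in powM m -> jet1 m v = 0.
Proof.
move=> vm; rewrite /jet1.
have -> : quotmod_pi (ideal_mul (ideal_pow (@fps_ideal A n) m) M) v = 0.
  by rewrite -[RHS](linear0 (quotmod_pi _)); apply/quotmod_eqP; rewrite subr0.
exact: tensor1_0.
Qed.

Lemma jet1_proj m v : jet_fibre_proj M p m (jet1 m.+1 v) = jet1 m v.
Proof. by rewrite [LHS]tensor_map1 /restr_map /= quotmod_projE. Qed.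

Lemma jet1_span m (x : fibre m) : x \in span (range (jet1 m)).
Proof.
apply: sub_span (tensor1_span x) => _ [u _ <-]; apply: mem_span.
exists (quotmod_repr (u : jet M m)) => //.
by rewrite /jet1 quotmod_reprK.
Qed.

Lemma jet_fibre_proj_surj m (y : fibre m) : exists x, jet_fibre_proj M p m x = y.
Proof.
have /spanP[k [c [g [gE ->]]]] := jet1_span y.
have /choice[v vE] i : exists v, jet1 m v = g i by have [v _ <-] := gE i; exists v.
exists (\sum_i c i *: jet1 m.+1 (v i)); rewrite linear_sum.
by apply: eq_bigr => i _; rewrite linearZ jet1_proj vE.
Qed.

(** The universal properties of the quotient by <x>^m M and of base change, combined. *)
Lemma jet_fibre_lift m (Q : lmodType (residue_field p)) (h : M -> Q) :
  {morph h : u v / u + v} ->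
  (forall a v, h (fpsC A n a *: v) = to_residue p a *: h v) ->
  (forall v, v \in powM m -> h v = 0) ->
  exists H : {linear fibre m -> Q}, forall v, H (jet1 m v) = h v.
Proof.
move=> hD hZ h0.
have hE u v : u - v \in powM m -> h u = h v.
  by move=> /h0 huv; rewrite -[u](subrK v) hD huv add0r.
have repr_pi v : quotmod_repr (quotmod_pi (ideal_mul (ideal_pow (@fps_ideal A n) m) M) v)
    - v \in powM m.
  by apply/quotmod_eqP; rewrite quotmod_reprK.
pose h' (x : jetA m) : Q := h (quotmod_repr (x : jet M m)).
have h'E v : h' (quotmod_pi _ v) = h v by apply: hE.
have [x y|a x|H HE] := @tensor_lift_ex _ _ (to_residue p) (jetA m) Q h'.
- rewrite -[x](quotmod_reprK (x : jet M m)) -[y](quotmod_reprK (y : jet M m)).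
  by rewrite -[_ + _]quotmod_piD !h'E hD.
- rewrite -[x](quotmod_reprK (x : jet M m)) -[a *: _]quotmod_piZ.
  by rewrite !h'E hZ.
by exists H => v; rewrite HE h'E.
Qed.

(** Multiplication by [r] preserves <x>^m M and so induces an endomorphism of the fibre. *)
Lemma jet1_eq0Z m r v : jet1 m v = 0 -> jet1 m (r *: v) = 0.
Proof.
move=> v0.
have [u w|a u|u um|H HE] := @jet_fibre_lift m _ (fun v => jet1 m (r *: v)).
- by rewrite scalerDr jet1D.
- by rewrite scalerA mulrC -scalerA jet1Z.
- by apply/jet1_eq0/rpredZ.
by rewrite -HE v0 linear0.
Qed.

(** By the hypothesis [jet1 m.+1] factors through the fibre at level [m]; the factor [H] is a left
    inverse of the projection. *)
Lemma jet_fibre_proj_inj m : (forall v, v \in powM m -> jet1 m.+1 v = 0) ->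
  forall x, jet_fibre_proj M p m x = 0 -> x = 0.
Proof.
move=> m0 x x0.
have [H HE] := jet_fibre_lift (@jet1D m.+1) (@jet1Z m.+1) m0.
have HjetE v : H (jet_fibre_proj M p m (jet1 m.+1 v)) = jet1 m.+1 v.
  exact: etrans (congr1 H (jet1_proj m v)) (HE v).
suff Hx : H (jet_fibre_proj M p m x) = x by rewrite -Hx x0 linear0.
have /spanP[k [c [g [gE ->]]]] := jet1_span x.
rewrite !linear_sum; apply: eq_bigr => i _; rewrite !linearZ.
by have [v _ gv] := gE i; rewrite -gv; congr (_ *: _); exact: HjetE.
Qed.

(** A product of m + 1 elements of <x> is one factor times a product of m. The latter vanishes at
    level m + 1, and multiplication by the former carries level m + 1 to level m + 2. *)
Lemma jet1_eq0S m : (forall v, v \in powM m -> jet1 m.+1 v = 0) ->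
  forall v, v \in powM m.+1 -> jet1 m.+2 v = 0.
Proof.
move=> m0 _ /spanP[k [c [g [gE ->]]]].
rewrite (big_morph _ (@jet1D m.+2) (jet1_eq0 (span0 _))) big1 // => i _.
apply: jet1_eq0Z; have [a [w [+ ->]]] := gE i.
move=> /spanP[l [b [s [sE ->]]]]; rewrite scaler_suml.
rewrite (big_morph _ (@jet1D m.+2) (jet1_eq0 (span0 _))) big1 // => j _.
rewrite -[b j *: _]/(b j * _) -scalerA; apply: jet1_eq0Z.
have [r [rI ->]] := sE j; rewrite big_ord_recl -scalerA.
(* [H] exists because [r ord0] maps <x>^(m+1) M into <x>^(m+2) M. *)
have [u u'|c' u|u um|H HE] := @jet_fibre_lift m.+1 _ (fun v => jet1 m.+2 (r ord0 *: v)).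
- by rewrite scalerDr jet1D.
- by rewrite scalerA mulrC -scalerA jet1Z.
- have /spanP[l' [b' [g' [g'E ->]]]] := um; rewrite scaler_sumr.
  apply: jet1_eq0; apply: rpred_sum => k' _.
  have [a' [w' [a'I ->]]] := g'E k'.
  rewrite scalerA mulrC -scalerA; apply: rpredZ; rewrite scalerA.
  by apply: mem_span; exists (r ord0 * a'), w'; split=> //; apply: ideal_pow_mul.
rewrite -HE m0 ?linear0 //; apply: mem_span.
eexists _, w; split; last by [].
by apply: mem_span; exists (fun i => r (fintype.lift ord0 i)).
Qed.

Lemma completed_fibre_spans d : completed_fibre_dim M p = Some d ->
  forall m, exists f : 'I_d -> fibre m, spans f.
Proof.
move=> /dim_option_spans[f fs] m.
exists (@invlim_ev _ _ (jet_fibre_proj M p) m \o f).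
by apply: spans_comp fs => y; apply/invlim_ev_surj/jet_fibre_proj_surj.
Qed.

(** One injective transition map makes all later ones injective, so evaluation at its target is an
    isomorphism from the completed fibre onto a space spanned by at most [d] elements. *)
Lemma completed_fibre_dim_leq d e (f : 'I_e -> fibre d.+1) : (e <= d)%N -> spans f ->
  exists2 c, completed_fibre_dim M p = Some c & (c <= d)%N.
Proof.
move=> ed fs.
have [i [c [g [cd gs tinj]]]] :=
  tower_injective_step (t := jet_fibre_proj M p) jet_fibre_proj_surj ed fs.
(* Injectivity is restated as the vanishing of <x>^i M one level up, the form that propagates. *)
have i0 v : v \in powM i -> jet1 i.+1 v = 0.
  by move=> /jet1_eq0 v0; apply: tinj; rewrite jet1_proj.
have ev_inj : injective (@invlim_ev _ _ (jet_fibre_proj M p) i).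
  apply: invlim_ev_inj => k ik; apply: jet_fibre_proj_inj.
  rewrite -(subnK ik); elim: (k - i)%N => [//|l IH].
  by rewrite addSn; apply: jet1_eq0S.
have /choice[h hE] j : exists x : invlim (jet_fibre_proj M p), invlim_ev i x = g j.
  exact/invlim_ev_surj/jet_fibre_proj_surj.
have hs : spans h.
  move=> x; have [b bE] := gs (invlim_ev i x); exists b.
  apply: ev_inj; rewrite bE linear_sum; apply: eq_bigr => j _.
  by rewrite linearZ -hE.
by have [c' dimE c'c] := dim_option_leq hs; exists c' => //; apply: leq_trans cd.
Qed.

End Jets.

(** * Neighbourhoods in the spectrum of A *)

Theorem corollary45 (A : comNzRingType) (n : nat) (M : lmodType (fps A n)) :
  noetherian A ->
  fin_gen M ->
  [\/ fin_gen (restr (fpsC A n) M),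
      krull_dim_is A 1,
      algebraically_presented M
    | complete_local_with_field A] ->
  (forall p : Spec A, exists U : set (Spec A),
      [/\ open U, U p
        & forall q, U q ->
            leq_option (completed_fibre_dim M q) (completed_fibre_dim M p)]) /\
  open [set p : Spec A | completed_fibre_dim M p <> None].
Proof.
move=> _ fgM _.
have semicont (p : Spec A) : exists U : set (Spec A), [/\ open U, U p
    & forall q, U q -> leq_option (completed_fibre_dim M q) (completed_fibre_dim M p)].
  case dE: (completed_fibre_dim M p) => [d|]; last first.
    by exists setT; split=> // [|q _]; [exact: openT | case: completed_fibre_dim].
  (* Below level d + 1 there are d + 1 transition maps, as many as the descent from at most d
     generators needs. *)
  have [s [g gs]] := jet_spans d.+1 fgM.
  have [f fs] := completed_fibre_spans dE d.+1.
  have [a ap [e ed aU]] := fibre_spans_open gs fs.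
  (* The basic open set on which [a] does not vanish. *)
  exists (zariski_compl [set a]); split.
  - by exists [set a].
  - by exists a.
  move=> q [_ -> /aU[h hs]].
  by have [c -> cd] := completed_fibre_dim_leq ed hs.
(* A neighbourhood on which the dimension is bounded by a finite value stays inside the locus. *)
split=> //; rewrite openE => p /= pfin; have [U [Uo Up Uq]] := semicont p.
rewrite /interior nbhsE; exists U => // q /Uq /=.
case: (completed_fibre_dim M p) pfin => // d _.
by case: (completed_fibre_dim M q).
Qed.
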